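(* Consider the real-valued block-sparse setting in the context with Gaussian noise $w\sim N(0,\sigma^2 I_L)$, and assume $x\ne0$. Suppose that for some constant $\alpha\ge 1/(2d\log N)$, $$(1-(d-1)\nu)x_{\min}-(2k-1)d\mu_B x_{\min}\ \ge\ 2\sigma\sqrt{2\alpha d(1+(d-1)\nu)\log N}.$$ Then, with probability exceeding $$1-\frac{0.8\,d\,(2\alpha d\log N)^{d/2-1}}{N^{\alpha d-1}},$$ the BOMP algorithm selects every element of $S$ among $\{i_1,\dots,i_k\}$ and $$\|\hat x_{\mathrm{BOMP}}-x\|_2^2\le\frac{2\alpha(1+(d-1)\nu)}{(1-(d-1)\nu-(k-1)d\mu_B)^2}\,d\,k\,\sigma^2\log N.$$
   Context: Setting: $N=Md$, $\log$ is the natural logarithm. For $v\in\mathbb{R}^N$, $v[i]=(v_{(i-1)d+1},\dots,v_{id})^T$ is its $i$-th block ($1\le i\le M$); for a matrix $A$ with $N$ columns, $A[i]$ is the submatrix of columns $(i-1)d+1,\dots,id$. The block support is $\mathrm{supp}(v)=\{i:v[i]\ne0\}$; for $I=\{i_1<\dots<i_p\}$, $A_I=[A[i_1],\dots,A[i_p]]$. The unknown deterministic $x\in\mathbb{R}^N$ has at most $k$ nonzero blocks ($k$ known); $S=\mathrm{supp}(x)$, $s=|S|$, $x_{\max}=\max_{i\in S}\|x[i]\|_2$, $x_{\min}=\min_{i\in S}\|x[i]\|_2$. Observations $y=Dx+w$, with $D\in\mathbb{R}^{L\times N}$ known, columns $d_1,\dots,d_N$ of unit $\ell_2$ norm, $L<N$,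 and $D_I$ of full column rank for all $|I|\le k$. Block coherence $\mu_B=\max_{i\ne j}\frac1d\|D[i]^TD[j]\|$ (spectral norm); sub-coherence $\nu=\max_{1\le\ell\le M}\max_{(\ell-1)d+1\le i\ne j\le\ell d}|d_i^Td_j|$. BOMP algorithm: set $r^0=y$. For $\ell=1,\dots,k$: choose $i_\ell\in\arg\max_i\|D[i]^Tr^{\ell-1}\|_2$ (ties arbitrary); let $x^\ell$ minimize $\|y-D\tilde x\|_2$ over $\tilde x$ with $\mathrm{supp}(\tilde x)\subseteq\{i_1,\dots,i_\ell\}$; set $r^\ell=y-Dx^\ell$. Output $\hat x_{\mathrm{BOMP}}=x^k$. *)

(* Defs.v *)
From HB Require Import structures.
From mathcomp Require Import all_boot all_order all_algebra.
From mathcomp Require Import all_classical all_reals all_analysis.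
Set Implicit Arguments. Unset Strict Implicit. Unset Printing Implicit Defensive.
Import Order.TTheory GRing.Theory Num.Theory.
Local Open Scope classical_set_scope.
Local Open Scope ring_scope.

Section BlockDefs.
Context {R : realType}.

Definition vnorm {n : nat} (v : 'cV[R]_n) : R := Num.sqrt (\sum_(i < n) v i 0 ^+ 2).

Lemma bidx_proof (M d : nat) (i : 'I_M) (j : 'I_d) : (i * d + j < M * d)%N.
Proof.
case: i j => i Hi [j Hj] /=.
apply: (@leq_trans (i * d + d)); first by rewrite ltn_add2l.
by rewrite -mulSnr leq_mul2r Hi orbT.
Qed.

(* The global index of the j-th entry (0-based) of block i (0-based):
   i*d + j, i.e. entry (i-1)d + j' of the paper with 1-based indices. *)
Definition bidx (M d : nat) (i : 'I_M) (j : 'I_d) : 'I_(M * d) :=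
  Ordinal (bidx_proof i j).

Definition blk {M d : nat} (v : 'cV[R]_(M * d)) (i : 'I_M) : 'cV[R]_d :=
  \col_(j < d) v (bidx i j) 0.

Definition Dblk {L M d : nat} (A : 'M[R]_(L, M * d)) (i : 'I_M) : 'M[R]_(L, d) :=
  \matrix_(r < L, j < d) A r (bidx i j).

Definition bsupp {M d : nat} (v : 'cV[R]_(M * d)) : {set 'I_M} :=
  [set i | blk v i != 0].

Definition opnorm {m n : nat} (A : 'M[R]_(m, n)) : R :=
  sup [set vnorm (A *m v) | v in [set v : 'cV[R]_n | vnorm v <= 1]].

Definition block_coherence {L M d : nat} (D : 'M[R]_(L, M * d)) : R :=
  \big[Num.max/0]_(i < M) \big[Num.max/0]_(j < M | j != i)
     (opnorm ((Dblk D i)^T *m Dblk D j) / d%:R).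

Definition sub_coherence {L M d : nat} (D : 'M[R]_(L, M * d)) : R :=
  \big[Num.max/0]_(l < M) \big[Num.max/0]_(i < d) \big[Num.max/0]_(j < d | j != i)
     `| \sum_(r < L) D r (bidx l i) * D r (bidx l j) |.

Definition xmin {M d : nat} (x : 'cV[R]_(M * d)) : R :=
  inf [set vnorm (blk x i) | i in [set i | i \in bsupp x]].

Definition is_ls_sol {L M d : nat} (D : 'M[R]_(L, M * d)) (y : 'cV[R]_L)
    (I : {set 'I_M}) (z : 'cV[R]_(M * d)) : Prop :=
  bsupp z \subset I /\
  forall z' : 'cV[R]_(M * d), bsupp z' \subset I ->
    vnorm (y - D *m z) <= vnorm (y - D *m z').

(* the set {i_1, ..., i_l} of the first l selected blocks
   (idx 0 = i_1, idx 1 = i_2, ...) *)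
Definition selected {M : nat} (idx : nat -> 'I_M) (l : nat) : {set 'I_M} :=
  [set i | [exists j : 'I_l, idx (nat_of_ord j) == i]].

(* A run of BOMP for k iterations (with some tie-breaking): idx l = i_{l+1},
   xs l = x^l (xs 0 = 0, so that r^0 = y - D xs 0 = y), r^l = y - D xs l. *)
Definition bomp_run {L M d : nat} (D : 'M[R]_(L, M * d)) (y : 'cV[R]_L) (k : nat)
    (idx : nat -> 'I_M) (xs : nat -> 'cV[R]_(M * d)) : Prop :=
  xs 0%N = 0 /\
  forall l : nat, (l < k)%N ->
    (forall i : 'I_M,
       vnorm ((Dblk D i)^T *m (y - D *m xs l))
         <= vnorm ((Dblk D (idx l))^T *m (y - D *m xs l))) /\
    is_ls_sol D y (selected idx l.+1) (xs l.+1).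

End BlockDefs.

Definition mutually_independent {R : realType} (dT : measure_display)
    (T : measurableType dT) (P : probability T R) (L : nat)
    (w : 'I_L -> {RV P >-> R}) : Prop :=
  forall B : 'I_L -> set R, (forall i, measurable (B i)) ->
    P [set t | forall i, B i (w i t)] = (\prod_(i < L) P (w i @^-1` B i))%E.

(* Main.v *)
(* Noise: with q_1, ..., q_d the columns of one block, the vector of inner products
   (q_j . w) only depends, up to an orthogonal change of coordinates of R^L, on at
   most d coordinates of w (QR factorisation by plane rotations, which preserve the
   law of an i.i.d. Gaussian family).  Gershgorin's theorem bounds the norm of the
   triangular factor, so |D[i]^T w|^2 <= sigma^2 (1 + (d-1) nu) S with S a sum of at most
   d squares of independent standard normal variables.  Conditioning on one of the
   squares gives by induction P(S >= t) <= (3/4) d^2 t^(d/2-1) e^(-t/2) for d >= 2,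
   and Mills' ratio gives sqrt(2/pi) t^(-1/2) e^(-t/2) for d = 1, where
   sqrt(2/pi) < 4/5.  A union bound over the blocks concludes.
   Recovery: when all |D[i]^T w| < tau, block coherence forces every greedy choice
   into the support until the support is exhausted, because the residual always
   has an error block at least as large as xmin; the normal equations of the last
   least-squares problem then bound the error. *)
Require Import Defs.
From HB Require Import structures.
From mathcomp Require Import all_boot all_order all_algebra.
From mathcomp Require Import all_classical all_reals all_analysis.
From mathcomp Require Import measurable_realfun ring lra.
Set Implicit Arguments.
Unset Strict Implicit.
Unset Printing Implicit Defensive.
Import Order.TTheory GRing.Theory Num.Theory.
Import numFieldNormedType.Exports.
Local Open Scope classical_set_scope.
Local Open Scope ring_scope.

(** * Euclidean norm and block structure *)

Section Euclid.
Context {R : realType}.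

(** No block is selected twice before the support is exhausted: the least-squares residual is
    orthogonal to every selected block, whereas the greedy choice has nonzero correlation. Hence k
    rounds suffice for a support of at most k blocks, and later rounds do no harm, since the error
    bound only uses that at most k blocks are selected. The noise is never given a law on R^L. Being
    i.i.d. normal is a product formula on boxes, so a plane rotation is checked on two coordinates
    while the others are frozen in an event; on the plane it becomes an identity between iterated
    Lebesgue integrals. The number n of squares left by the elimination is only known to be at most
    d, so the tail bound for n must be dominated by its form at d. This holds for t >= 1, which is
    what alpha >= 1/(2 d log N) gives with t = 2 alpha d log N. The factor d^2 summed over M blocks
    becomes d N, hence the exponent alpha d - 1 of N. The constant 4/5 must exceed both 3/4 and
    sqrt(2/pi); the second comparison amounts to pi > 25/8. *)

Definition dot {n} (u v : 'cV[R]_n) : R := \sum_(i < n) u i 0 * v i 0.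

Lemma dotC n (u v : 'cV[R]_n) : dot u v = dot v u.
Proof. by apply: eq_bigr => i _; rewrite mulrC. Qed.

Lemma dotDl n (u v z : 'cV[R]_n) : dot (u + v) z = dot u z + dot v z.
Proof. by rewrite /dot -big_split; apply: eq_bigr => i _; rewrite !mxE mulrDl. Qed.

Lemma dotZl n a (u v : 'cV[R]_n) : dot (a *: u) v = a * dot u v.
Proof. by rewrite /dot mulr_sumr; apply: eq_bigr => i _; rewrite !mxE mulrA. Qed.

Lemma dotDr n (u v z : 'cV[R]_n) : dot z (u + v) = dot z u + dot z v.
Proof. by rewrite dotC dotDl !(dotC z). Qed.

Lemma dotZr n a (u v : 'cV[R]_n) : dot u (a *: v) = a * dot u v.
Proof. by rewrite dotC dotZl dotC. Qed.

Lemma dotNl n (u v : 'cV[R]_n) : dot (- u) v = - dot u v.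
Proof. by rewrite -scaleN1r dotZl mulN1r. Qed.

Lemma dotNr n (u v : 'cV[R]_n) : dot u (- v) = - dot u v.
Proof. by rewrite dotC dotNl dotC. Qed.

Lemma dot0l n (v : 'cV[R]_n) : dot 0 v = 0.
Proof. by rewrite -(scale0r v) dotZl mul0r. Qed.

Lemma dot_suml n (I : Type) (s : seq I) (Q : pred I) (F : I -> 'cV[R]_n) v :
  dot (\sum_(i <- s | Q i) F i) v = \sum_(i <- s | Q i) dot (F i) v.
Proof.
by apply: (big_morph (fun u => dot u v)) => [a b|]; rewrite ?dotDl ?dot0l.
Qed.

Lemma dot_sumr n (I : Type) (s : seq I) (Q : pred I) (F : I -> 'cV[R]_n) v :
  dot v (\sum_(i <- s | Q i) F i) = \sum_(i <- s | Q i) dot v (F i).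
Proof. by rewrite dotC dot_suml; apply: eq_bigr => i _; rewrite dotC. Qed.

Lemma dot_ge0 n (v : 'cV[R]_n) : 0 <= dot v v.
Proof. by apply: sumr_ge0 => i _; rewrite -expr2 sqr_ge0. Qed.

Lemma dot_eq0 n (v : 'cV[R]_n) : dot v v = 0 -> v = 0.
Proof.
move=> h; apply/colP => i; rewrite mxE; apply/eqP; rewrite -sqrf_eq0 expr2.
by apply/eqP; move/psumr_eq0P: h => -> // j _; rewrite -expr2 sqr_ge0.
Qed.

Lemma dot_mulmx n m (A : 'M[R]_(n, m)) u v : dot (A^T *m u) v = dot u (A *m v).
Proof.
rewrite /dot.
under eq_bigr do rewrite mxE mulr_suml.
rewrite exchange_big; apply: eq_bigr => i _.
by rewrite mxE mulr_sumr; apply: eq_bigr => j _; rewrite mxE; ring.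
Qed.

Lemma vnorm_ge0 n (v : 'cV[R]_n) : 0 <= vnorm v.
Proof. exact: sqrtr_ge0. Qed.

Lemma vnormE n (v : 'cV[R]_n) : vnorm v = Num.sqrt (dot v v).
Proof. by congr Num.sqrt; apply: eq_bigr => i _; rewrite expr2. Qed.

Lemma sqr_vnorm n (v : 'cV[R]_n) : vnorm v ^+ 2 = dot v v.
Proof. by rewrite vnormE sqr_sqrtr ?dot_ge0. Qed.

Lemma vnorm0 n : vnorm (0 : 'cV[R]_n) = 0.
Proof. by rewrite vnormE dot0l sqrtr0. Qed.

Lemma vnorm_eq0 n (v : 'cV[R]_n) : vnorm v = 0 -> v = 0.
Proof. by move=> h; apply: dot_eq0; rewrite -sqr_vnorm h expr0n. Qed.

Lemma vnorm_gt0 n (v : 'cV[R]_n) : v != 0 -> 0 < vnorm v.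
Proof.
move=> v0; rewrite lt_def vnorm_ge0 andbT.
by apply: contra_neq v0; exact: vnorm_eq0.
Qed.

Lemma vnormN n (v : 'cV[R]_n) : vnorm (- v) = vnorm v.
Proof. by rewrite !vnormE dotNl dotNr opprK. Qed.

Lemma cauchy_schwarz n (u v : 'cV[R]_n) : dot u v <= vnorm u * vnorm v.
Proof.
have [->|v0] := eqVneq v 0; first by rewrite dotC dot0l vnorm0 mulr0.
have vp : 0 < vnorm v by exact: vnorm_gt0.
have h : dot u v ^+ 2 <= (vnorm u * vnorm v) ^+ 2.
  have := dot_ge0 (dot v v *: u - dot u v *: v).
  rewrite dotDl !dotDr !dotZl !dotNl !dotNr !dotZl !dotZr (dotC v u) opprK exprMn !sqr_vnorm.
  have vv : 0 < dot v v by rewrite -sqr_vnorm exprn_gt0.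
  move=> h; rewrite -(ler_pM2l vv) -subr_ge0; apply: le_trans h _.
  by rewrite le_eqVlt; apply/orP; left; apply/eqP; ring.
have [neg|pos] := ltP (dot u v) 0.
  by rewrite (le_trans (ltW neg))// mulr_ge0 ?vnorm_ge0.
by rewrite -ler_sqr// nnegrE ?mulr_ge0 ?vnorm_ge0.
Qed.

Lemma cauchy_schwarz_abs n (u v : 'cV[R]_n) : `|dot u v| <= vnorm u * vnorm v.
Proof.
rewrite ler_norml cauchy_schwarz andbT lerNl -dotNl.
by rewrite -(vnormN u) cauchy_schwarz.
Qed.

Lemma vnormD n (u v : 'cV[R]_n) : vnorm (u + v) <= vnorm u + vnorm v.
Proof.
rewrite -ler_sqr ?nnegrE ?addr_ge0 ?vnorm_ge0//.
rewrite sqr_vnorm dotDl !dotDr sqrrD !sqr_vnorm (dotC v u).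
have := cauchy_schwarz u v; lra.
Qed.

Lemma sqr_vnormBZ n (u v : 'cV[R]_n) a :
  vnorm (u - a *: v) ^+ 2 = dot u u - 2 * a * dot u v + a ^+ 2 * dot v v.
Proof.
by rewrite sqr_vnorm dotDl !dotDr !dotNl !dotNr !dotZl !dotZr (dotC v u); ring.
Qed.

Lemma vnormB n (u v : 'cV[R]_n) : vnorm u - vnorm v <= vnorm (u - v).
Proof. by rewrite lerBlDr -{1}(subrK v u) vnormD. Qed.

Lemma vnorm_sum n (I : Type) (s : seq I) (Q : pred I) (F : I -> 'cV[R]_n) :
  vnorm (\sum_(i <- s | Q i) F i) <= \sum_(i <- s | Q i) vnorm (F i).
Proof.
elim/big_rec2: _ => [|i a b _ h]; first by rewrite vnorm0.
by apply: le_trans (vnormD _ _) _; rewrite lerD2l.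
Qed.

Lemma vnormZ n a (v : 'cV[R]_n) : 0 <= a -> vnorm (a *: v) = a * vnorm v.
Proof.
by move=> a0; rewrite !vnormE dotZl dotZr mulrA sqrtrM ?mulr_ge0// -expr2 sqrtr_sqr ger0_norm.
Qed.

Lemma opnormP m n (A : 'M[R]_(m, n)) v : vnorm (A *m v) <= opnorm A * vnorm v.
Proof.
(* The Frobenius norm serves only to bound the set under [sup], so that [opnorm] really is an upper
   bound of it. *)
pose F := Num.sqrt (\sum_(i < m) \sum_(j < n) A i j ^+ 2).
have F0 : 0 <= F by exact: sqrtr_ge0.
have SF : 0 <= \sum_(i < m) \sum_(j < n) A i j ^+ 2.
  by apply: sumr_ge0 => i _; apply: sumr_ge0 => j _; rewrite sqr_ge0.
have hF u : vnorm (A *m u) <= F * vnorm u.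
  rewrite -ler_sqr ?nnegrE ?mulr_ge0 ?vnorm_ge0// exprMn [X in _ <= X * _]sqr_sqrtr//.
  rewrite sqr_vnorm mulr_suml; apply: ler_sum => i _.
  have -> : (A *m u) i 0 = dot ((row i A)^T) u.
    by rewrite mxE; apply: eq_bigr => j _; rewrite !mxE.
  have -> : \sum_(j < n) A i j ^+ 2 = vnorm (row i A)^T ^+ 2.
    by rewrite sqr_vnorm; apply: eq_bigr => j _; rewrite !mxE expr2.
  rewrite -expr2 -exprMn -real_normK ?num_real// ler_sqr ?nnegrE ?mulr_ge0 ?vnorm_ge0//.
  exact: cauchy_schwarz_abs.
have hs u : vnorm u <= 1 -> vnorm (A *m u) <= opnorm A.
  move=> u1; apply: ub_le_sup; last by exists u.
  exists F => _ [z z1 <-]; apply: le_trans (hF z) _.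
  by rewrite ler_piMr.
have [->|v0] := eqVneq v 0; first by rewrite mulmx0 !vnorm0 mulr0.
have vp : 0 < vnorm v by exact: vnorm_gt0.
have := hs ((vnorm v)^-1 *: v).
rewrite -scalemxAr !vnormZ ?invr_ge0 ?(ltW vp)// mulVf ?gt_eqF// => /(_ (lexx _)).
by rewrite mulrC ler_pdivrMr.
Qed.

Lemma sqr_sum_le (I : finType) (A : {set I}) (a : I -> R) :
  (\sum_(i in A) a i) ^+ 2 <= #|A|%:R * \sum_(i in A) a i ^+ 2.
Proof.
rewrite expr2 mulr_suml.
under eq_bigr do rewrite mulr_sumr.
have -> : #|A|%:R * \sum_(i in A) a i ^+ 2 =
    \sum_(i in A) \sum_(j in A) (a i ^+ 2 / 2 + a j ^+ 2 / 2).
  under [RHS]eq_bigr do rewrite big_split /= sumr_const -(mulr_natl _ #|A|).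
  rewrite big_split /= sumr_const -mulr_sumr -mulr_suml -(mulr_natl _ #|A|).
  lra.
apply: ler_sum => i _; apply: ler_sum => j _.
have := sqr_ge0 (a i - a j); rewrite sqrrB; lra.
Qed.

(** Cauchy-Schwarz bounds the full double sum by [#|A|] times the sum of squares, and removing the
    diagonal takes off exactly one. This is the Gershgorin estimate, used both inside a block and
    between blocks. *)
Lemma offdiag_le (I : finType) (A : {set I}) (a : I -> R) :
  \sum_(i in A) \sum_(j in A | j != i) a i * a j
    <= (#|A|%:R - 1) * \sum_(i in A) a i ^+ 2.
Proof.
have := sqr_sum_le A a; rewrite expr2 mulr_suml.
have -> : \sum_(i in A) a i * \sum_(j in A) a j =
    \sum_(i in A) a i ^+ 2 + \sum_(i in A) \sum_(j in A | j != i) a i * a j.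
  rewrite -big_split; apply: eq_bigr => i iA /=.
  by rewrite (bigD1 i)//= mulrDr expr2 mulr_sumr.
lra.
Qed.

End Euclid.

(** * Block decomposition, coherence estimates and normal equations *)

Section Blocks.
Context {R : realType}.
Variables (L M d : nat).
Implicit Types (D : 'M[R]_(L, M * d)) (u v x y z h : 'cV[R]_(M * d)).

Lemma sum_bidx (F : 'I_(M * d) -> R) :
  \sum_k F k = \sum_(i < M) \sum_(j < d) F (bidx i j).
Proof.
rewrite pair_bigA /=.
have [d0|d0] := posnP d.
  rewrite [LHS]big1 => [|k _]; last first.
    by have := ltn_ord k; rewrite {2}d0 muln0.
  by rewrite big1 // => -[i j] _; have := ltn_ord j; rewrite {2}d0.
have hdiv (k : 'I_(M * d)) : (k %/ d < M)%N by rewrite ltn_divLR.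
have hmod (k : 'I_(M * d)) : (k %% d < d)%N by rewrite ltn_mod.
rewrite (reindex (fun p : 'I_M * 'I_d => bidx p.1 p.2)) //.
exists (fun k => (Ordinal (hdiv k), Ordinal (hmod k))) => [[i j] _|k _].
  congr (_, _); apply: val_inj => /=.
    by rewrite divnMDl // divn_small ?addn0.
  by rewrite modnMDl modn_small.
by apply: val_inj => /=; rewrite -divn_eq.
Qed.

Lemma mulmx_blocks D v : D *m v = \sum_i Dblk D i *m blk v i.
Proof.
apply/colP => r; rewrite summxE mxE sum_bidx; apply: eq_bigr => i _.
by rewrite mxE; apply: eq_bigr => j _; rewrite !mxE.
Qed.

Lemma dot_blocks u v : dot u v = \sum_i dot (blk u i) (blk v i) :> R.
Proof.
by rewrite /dot sum_bidx; apply: eq_bigr => i _; apply: eq_bigr => j _; rewrite !mxE.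
Qed.

Lemma blkD u v i : blk (u + v) i = blk u i + blk v i :> 'cV[R]_d.
Proof. by apply/colP => j; rewrite !mxE. Qed.

Lemma blkN u i : blk (- u) i = - blk u i :> 'cV[R]_d.
Proof. by apply/colP => j; rewrite !mxE. Qed.

Lemma blkZ a u i : blk (a *: u) i = a *: blk u i :> 'cV[R]_d.
Proof. by apply/colP => j; rewrite !mxE. Qed.

Lemma blk_out (I : {set 'I_M}) v i : bsupp v \subset I -> i \notin I -> blk v i = 0.
Proof.
move=> /fintype.subsetP vI; apply: contraNeq => h; apply: vI.
by rewrite inE.
Qed.

Lemma mulmx_blocks_in D v (I : {set 'I_M}) : bsupp v \subset I ->
  D *m v = \sum_(i in I) Dblk D i *m blk v i.
Proof.
move=> vI; rewrite mulmx_blocks [RHS]big_mkcond; apply: eq_bigr => i _.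
by case: ifPn => // iI; rewrite (blk_out vI iI) mulmx0.
Qed.

Lemma dot_blocks_in u v (I : {set 'I_M}) : bsupp v \subset I ->
  dot u v = \sum_(i in I) dot (blk u i) (blk v i) :> R.
Proof.
move=> vI; rewrite dot_blocks [RHS]big_mkcond; apply: eq_bigr => i _.
by case: ifPn => // iI; rewrite (blk_out vI iI) dotC dot0l.
Qed.

Lemma bsuppD u v (I : {set 'I_M}) :
  bsupp u \subset I -> bsupp v \subset I -> bsupp (u + v : 'cV[R]_(M * d)) \subset I.
Proof.
move=> uI vI; apply/fintype.subsetP => i; apply: contraTT => iI; rewrite inE negbK.
by rewrite blkD (blk_out uI) ?(blk_out vI) ?addr0.
Qed.

Lemma bsuppZ a v (I : {set 'I_M}) :
  bsupp v \subset I -> bsupp (a *: v : 'cV[R]_(M * d)) \subset I.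
Proof.
move=> vI; apply/fintype.subsetP => i; apply: contraTT => iI; rewrite inE negbK.
by rewrite blkZ (blk_out vI) ?scaler0.
Qed.

Lemma block_coherence_ge0 D : 0 <= block_coherence D.
Proof. exact: bigmax_ge_id. Qed.

Lemma sub_coherence_ge0 D : 0 <= sub_coherence D.
Proof. exact: bigmax_ge_id. Qed.

Lemma block_coherenceP D i j (v : 'cV[R]_d) : (0 < d)%N -> i != j ->
  vnorm ((Dblk D i)^T *m (Dblk D j *m v)) <= d%:R * block_coherence D * vnorm v.
Proof.
move=> d0 ij; rewrite mulmxA; apply: le_trans (opnormP _ _) _.
apply: ler_wpM2r; first exact: vnorm_ge0.
rewrite mulrC -ler_pdivrMr ?ltr0n//.
apply: (@le_trans _ _ (\big[Num.max/0]_(j < M | j != i)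
     (opnorm ((Dblk D i)^T *m Dblk D j) / d%:R))).
  by apply: (le_bigmax_cond _ (fun j => opnorm ((Dblk D i)^T *m Dblk D j) / d%:R)); rewrite eq_sym.
exact: (le_bigmax _ (fun i => \big[Num.max/0]_(j < M | j != i)
     (opnorm ((Dblk D i)^T *m Dblk D j) / d%:R))).
Qed.

Lemma sub_coherenceP D l i j : i != j ->
  `|\sum_(r < L) D r (bidx l i) * D r (bidx l j)| <= sub_coherence D.
Proof.
move=> ij.
apply: le_trans (le_bigmax _ (fun l => \big[Num.max/0]_(i < d) \big[Num.max/0]_(j < d | j != i)
     `| \sum_(r < L) D r (bidx l i) * D r (bidx l j) |) l).
apply: le_trans (le_bigmax _ (fun i => \big[Num.max/0]_(j < d | j != i)
     `| \sum_(r < L) D r (bidx l i) * D r (bidx l j) |) i).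
by apply: (le_bigmax_cond _ (fun j => `| \sum_(r < L) D r (bidx l i) * D r (bidx l j) |));
  rewrite eq_sym.
Qed.

(* Gershgorin's circle theorem for the Gram matrix of one block *)
Lemma block_gram D l (v : 'cV[R]_d) : (forall c, vnorm (col c D) = 1) ->
  `|vnorm (Dblk D l *m v) ^+ 2 - vnorm v ^+ 2|
     <= (d%:R - 1) * sub_coherence D * vnorm v ^+ 2.
Proof.
move=> unitD; rewrite !sqr_vnorm -dot_mulmx.
pose g i j := \sum_(r < L) D r (bidx l i) * D r (bidx l j).
have gii i : g i i = 1.
  rewrite -[RHS](expr1n _ 2) -(unitD (bidx l i)) sqr_vnorm.
  by apply: eq_bigr => r _; rewrite !mxE.
have -> : dot ((Dblk D l)^T *m (Dblk D l *m v)) v =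
    \sum_i \sum_j g i j * (v i 0 * v j 0).
  apply: eq_bigr => i _; rewrite mulmxA mxE mulr_suml; apply: eq_bigr => j _.
  rewrite mxE -mulrA (mulrC (v j 0)); congr (_ * _).
  by apply: eq_bigr => r _; rewrite !mxE.
have -> : \sum_i \sum_j g i j * (v i 0 * v j 0) - dot v v =
    \sum_i \sum_(j | j != i) g i j * (v i 0 * v j 0).
  rewrite -sumrB; apply: eq_bigr => i _.
  by rewrite (bigD1 i) //= gii mul1r addrAC subrr add0r.
apply: le_trans (ler_norm_sum _ _ _) _.
apply: (@le_trans _ _ (\sum_i \sum_(j | j != i) sub_coherence D * (`|v i 0| * `|v j 0|))).
  apply: ler_sum => i _; apply: le_trans (ler_norm_sum _ _ _) _.
  apply: ler_sum => j ji; rewrite !normrM ler_wpM2r ?mulr_ge0//.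
  by apply: sub_coherenceP; rewrite eq_sym.
under eq_bigr do rewrite -mulr_sumr.
rewrite -mulr_sumr -mulrA mulrCA ler_wpM2l ?sub_coherence_ge0//.
have := offdiag_le [set: 'I_d] (fun i => `|v i 0|).
rewrite cardsT card_ord (eq_bigl xpredT) => [|i]; last by rewrite inE.
rewrite [X in _ <= _ * X -> _](eq_bigl xpredT) => [|i]; last by rewrite inE.
congr (_ <= _ * _); last by apply: eq_bigr => i _; rewrite real_normK ?num_real// expr2.
by apply: eq_bigr => i _; apply: eq_bigl => j; rewrite inE.
Qed.

Section Coherence.
Variable D : 'M[R]_(L, M * d).
Hypothesis d0 : (0 < d)%N.
Hypothesis unitD : forall c, vnorm (col c D) = 1.
Let nu := sub_coherence D.
Let mu := block_coherence D.

(** Cauchy-Schwarz turns the lower bound on the quadratic form of the Gram matrix into one on the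
    norm of its image. *)
Lemma block_gram_ge l (v : 'cV[R]_d) :
  (1 - (d%:R - 1) * nu) * vnorm v <= vnorm ((Dblk D l)^T *m (Dblk D l *m v)).
Proof.
have [->|v0] := eqVneq v 0; first by rewrite vnorm0 mulr0 vnorm_ge0.
rewrite -(ler_pM2r (vnorm_gt0 v0)); apply: le_trans (cauchy_schwarz _ _).
rewrite dot_mulmx -sqr_vnorm -mulrA -expr2.
have := block_gram l v unitD; rewrite ler_norml => /andP[+ _].
rewrite -/nu; lra.
Qed.

(** Gershgorin at the level of blocks: each diagonal term loses [(d - 1) nu], and each of the at
    most [p - 1] other blocks costs [d mu]. *)
Lemma quad_ge (I : {set 'I_M}) h p : bsupp h \subset I -> (#|I| <= p)%N ->
  (1 - (d%:R - 1) * nu - (p%:R - 1) * d%:R * mu) * vnorm h ^+ 2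
    <= vnorm (D *m h) ^+ 2.
Proof.
move=> hI Ip.
have mu0 : 0 <= d%:R * mu by rewrite mulr_ge0// block_coherence_ge0.
have dd : vnorm h ^+ 2 = \sum_(i in I) vnorm (blk h i) ^+ 2.
  by rewrite sqr_vnorm (dot_blocks_in _ hI); apply: eq_bigr => i _; rewrite sqr_vnorm.
have -> : vnorm (D *m h) ^+ 2 = \sum_(i in I) (vnorm (Dblk D i *m blk h i) ^+ 2 +
    \sum_(j in I | j != i) dot (Dblk D i *m blk h i) (Dblk D j *m blk h j)).
  rewrite sqr_vnorm (mulmx_blocks_in D hI) dot_suml; apply: eq_bigr => i iI.
  by rewrite dot_sumr (bigD1 i)//= sqr_vnorm.
rewrite big_split /= mulrBl; apply: lerD.
  rewrite dd mulr_sumr; apply: ler_sum => i _.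
  have := block_gram i (blk h i) unitD; rewrite ler_norml => /andP[+ _].
  rewrite -/nu; lra.
apply: (@le_trans _ _ (- (d%:R * mu * \sum_(i in I) \sum_(j in I | j != i)
    vnorm (blk h i) * vnorm (blk h j)))).
  rewrite lerN2 dd.
  have -> (S : R) : (p%:R - 1) * d%:R * mu * S = d%:R * mu * ((p%:R - 1) * S) by ring.
  apply: ler_wpM2l => //.
  have := offdiag_le I (fun i => vnorm (blk h i)); move/le_trans; apply.
  apply: ler_wpM2r; first by apply: sumr_ge0 => i _; exact: sqr_ge0.
  by rewrite lerD2r ler_nat.
rewrite mulr_sumr -sumrN; apply: ler_sum => i iI.
rewrite mulr_sumr -sumrN; apply: ler_sum => j /andP[jI ji].
rewrite lerNl -dotNl -mulmxN -dot_mulmx.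
apply: le_trans (cauchy_schwarz _ _) _.
by rewrite !mulmxN vnormN (mulrA _ _ (vnorm _)) ler_wpM2r ?vnorm_ge0// block_coherenceP.
Qed.

End Coherence.

(** A minimiser is stationary in every admissible direction. The direction tested is block [i]
    filled with the correlation [g] itself, along which the squared residual has derivative
    [- 2 |g|^2]. *)
Lemma ls_normal_eq D (y : 'cV[R]_L) (I : {set 'I_M}) z i :
  is_ls_sol D y I z -> i \in I -> (Dblk D i)^T *m (y - D *m z) = 0.
Proof.
move=> [zI zmin] iI; set r := y - D *m z; set g := _ *m r.
pose v : 'cV[R]_(M * d) := \col_k \sum_(j < d) (k == bidx i j)%:R * g j 0.
have bidx_inj i' j j' : (bidx i' j == bidx i j' :> 'I_(M * d)) = (i' == i) && (j == j').
  apply/eqP/andP => [/(congr1 val)/= e|[/eqP-> /eqP->//]].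
  have d0 : (0 < d)%N := leq_ltn_trans (leq0n j) (ltn_ord j).
  have := congr1 (divn^~ d) e; rewrite !divnMDl// !divn_small// !addn0 => /val_inj ->.
  by have := congr1 (modn^~ d) e; rewrite !modnMDl !modn_small// => /val_inj ->.
have bv i' : blk v i' = if i' == i then g else 0.
  apply/colP => j; rewrite !mxE; under eq_bigr do rewrite bidx_inj.
  case: (eqVneq i' i) => [_|_] /=; last by rewrite big1 ?mxE// => ? _; rewrite mul0r.
  rewrite (bigD1 j)//= eqxx mul1r big1 ?addr0// => k kj.
  by rewrite eq_sym (negbTE kj) mul0r.
have vI : bsupp v \subset I.
  apply/fintype.subsetP => i'; rewrite inE bv.
  by case: ifPn => [/eqP ->//|]; rewrite eqxx.
have Dv : D *m v = Dblk D i *m g.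
  rewrite mulmx_blocks (bigD1 i)//= bv eqxx big1 ?addr0// => i' i'i.
  by rewrite bv (negbTE i'i) mulmx0.
have gg : dot r (D *m v) = dot g g by rewrite Dv -dot_mulmx.
have key (e : R) : 0 <= e -> 0 <= e * (e * dot (D *m v) (D *m v) - 2 * dot g g).
  move=> e0; have := zmin (z + e *: v) (bsuppD zI (bsuppZ _ vI)).
  rewrite mulmxDr -scalemxAr opprD addrA -/r -ler_sqr ?nnegrE ?vnorm_ge0//.
  rewrite sqr_vnormBZ sqr_vnorm gg; lra.
apply: dot_eq0; apply/eqP; rewrite eq_le dot_ge0 andbT leNgt; apply/negP => g0.
set q := dot (D *m v) (D *m v) in key.
have q0 : 0 <= q by exact: dot_ge0.
(* Any positive step below [2 |g|^2 / q] would contradict minimality; the [+ 1] keeps the quotient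
   meaningful when [q = 0]. *)
have e0 : 0 < dot g g / (q + 1) by rewrite divr_gt0// ltr_wpDl.
have := key _ (ltW e0); rewrite pmulr_rge0//.
apply/negP; rewrite -ltNge subr_lt0 mulrAC ltr_pdivrMr ?ltr_wpDl//.
nra.
Qed.
End Blocks.

(** * Exact recovery under bounded noise *)

Section Greedy.
Context {R : realType}.
Variables (L M d k : nat) (D : 'M[R]_(L, M * d)).
Hypothesis d0 : (0 < d)%N.
Hypothesis unitD : forall c, vnorm (col c D) = 1.
Let nu := sub_coherence D.
Let mu := block_coherence D.
Implicit Types x e h : 'cV[R]_(M * d).

Lemma xmin_le x i : i \in bsupp x -> xmin x <= vnorm (blk x i).
Proof.
move=> iS; apply: ge_inf; last by exists i.
by exists 0 => _ [j _ <-]; exact: vnorm_ge0.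
Qed.

Lemma bsupp0P x : x != 0 -> exists i, i \in bsupp x.
Proof.
apply: contra_neqP => /forallNP h; apply: dot_eq0.
rewrite dot_blocks big1// => i _.
by have /negP := h i; rewrite inE negbK => /eqP ->; rewrite dot0l.
Qed.

Lemma xmin_ge0 x : x != 0 -> 0 <= xmin x.
Proof.
move=> /bsupp0P[i iS]; apply: lb_le_inf; first by exists (vnorm (blk x i)), i.
by move=> _ [j _ <-]; exact: vnorm_ge0.
Qed.

Lemma selectedS (idx : nat -> 'I_M) l :
  selected idx l.+1 = idx l |: selected idx l.
Proof.
apply/setP => i; rewrite !inE; apply/existsP/orP => [[j /eqP <-]|].
  have := ltn_ord j; rewrite ltnS leq_eqVlt => /orP[/eqP ->|jl]; first by left.
  by right; apply/existsP; exists (Ordinal jl).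
move=> [/eqP ->|/existsP[j /eqP <-]]; first by exists ord_max.
by exists (widen_ord (leqnSn l) j).
Qed.

Lemma selected0 (idx : nat -> 'I_M) : selected idx 0 = finset.set0.
Proof. by apply/setP => i; rewrite !inE; apply/existsP => -[[]]. Qed.

Lemma card_selected (idx : nat -> 'I_M) l : (#|selected idx l| <= l)%N.
Proof.
elim: l => [|l IH]; first by rewrite selected0 cards0.
by rewrite selectedS; apply: leq_trans (leq_card_setU _ _) _; rewrite cards1 add1n ltnS.
Qed.

Lemma crosstalk_le e (J : {set 'I_M}) i (E : R) : i \notin J ->
  (forall j, j \in J -> vnorm (blk e j) <= E) ->
  vnorm (\sum_(j in J) (Dblk D i)^T *m (Dblk D j *m blk e j))
    <= #|J|%:R * (d%:R * mu * E).
Proof.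
move=> iJ eE; apply: le_trans (vnorm_sum _ _ _) _.
rewrite mulr_natl -sumr_const; apply: ler_sum => j jJ.
apply: le_trans (block_coherenceP D _ d0 _) _; first by apply: contraNneq iJ => ->.
by apply: ler_wpM2l; [rewrite mulr_ge0// block_coherence_ge0|exact: eE].
Qed.

(** The largest error block, of norm [E], has correlation above
    [(1 - (d - 1) nu - (k - 1) d mu) E - tau], and a block outside [S] stays below [k d mu E + tau].
    The two crosstalk counts [k - 1] and [k] add up to the [2 k - 1] of the separation
    hypothesis. *)
Lemma greedy_step e (S : {set 'I_M}) (noise : 'cV[R]_L) tau xm i1 :
  (#|S| <= k)%N -> bsupp e \subset S ->
  (forall i, vnorm ((Dblk D i)^T *m noise) < tau) ->
  0 < 1 - (d%:R - 1) * nu - (2 * k%:R - 1) * d%:R * mu ->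
  2 * tau <= (1 - (d%:R - 1) * nu - (2 * k%:R - 1) * d%:R * mu) * xm ->
  i1 \in S -> xm <= vnorm (blk e i1) ->
  forall i, (forall j, vnorm ((Dblk D j)^T *m (D *m e + noise))
                <= vnorm ((Dblk D i)^T *m (D *m e + noise))) ->
  i \in S /\ (Dblk D i)^T *m (D *m e + noise) != 0.
Proof.
move=> Sk eS noiselt kap0 hxm i1S xme i imax.
have mu0 : 0 <= d%:R * mu by rewrite mulr_ge0// block_coherence_ge0.
have [i0 i0S emax] : exists2 i0, i0 \in S & forall j, j \in S -> vnorm (blk e j) <= vnorm (blk e i0).
  by case: (arg_maxP (fun j => vnorm (blk e j)) i1S) => i0 i0S h; exists i0.
set E := vnorm (blk e i0) in emax.
have E0 : 0 <= E by exact: vnorm_ge0.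
have mE : 0 <= d%:R * mu * E := mulr_ge0 mu0 E0.
(* Positivity of the factor lets [xm] be replaced by the larger [E]. *)
have xmE : 2 * tau <= (1 - (d%:R - 1) * nu - (2 * k%:R - 1) * d%:R * mu) * E.
  by apply: le_trans hxm _; rewrite ler_pM2l// (le_trans xme)// emax.
have split_r j : (Dblk D j)^T *m (D *m e + noise) =
    \sum_(l in S) (Dblk D j)^T *m (Dblk D l *m blk e l) + (Dblk D j)^T *m noise.
  by rewrite mulmxDr (mulmx_blocks_in D eS) mulmx_sumr.
have Si0 : (#|S :\ i0|.+1 <= k)%N by move: Sk; rewrite (cardsD1 i0) i0S.
have low : (1 - (d%:R - 1) * nu) * E - (k%:R - 1) * (d%:R * mu * E) - tau
    < vnorm ((Dblk D i0)^T *m (D *m e + noise)).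
  rewrite split_r (big_setD1 i0)//=.
  set a := _ *m (_ *m blk e i0); set b := \sum_(_ in _) _; set n := _ *m noise.
  have ha : (1 - (d%:R - 1) * nu) * E <= vnorm a by exact: block_gram_ge.
  have hb : vnorm b <= (k%:R - 1) * (d%:R * mu * E).
    apply: (@le_trans _ _ (#|S :\ i0|%:R * (d%:R * mu * E))).
      apply: crosstalk_le; first by rewrite !inE eqxx.
      by move=> j /setD1P[_ /emax].
    by rewrite ler_wpM2r// lerBrDr natr1 ler_nat.
  have hn : vnorm n < tau by exact: noiselt.
  have := vnormB (a + b + n) n; rewrite addrK.
  have := vnormB (a + b) b; rewrite addrK.
  have := vnormB (a - (- b)) (- n); rewrite !opprK !vnormN.
  have := vnormB a (- b); rewrite opprK vnormN.
  lra.
have iS : i \in S.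
  apply/negPn/negP => iS.
  have up : vnorm ((Dblk D i)^T *m (D *m e + noise)) < k%:R * (d%:R * mu * E) + tau.
    rewrite split_r; apply: le_lt_trans (vnormD _ _) _; apply: ler_ltD => //.
    apply: le_trans (crosstalk_le iS emax) _.
    by rewrite ler_wpM2r// ler_nat.
  have := imax i0; rewrite leNgt => /negP; apply; apply: (lt_le_trans up); apply/ltW.
  apply: le_lt_trans low; lra.
(* The lower bound [low] is at least [tau + k d mu E], hence positive; this is what will exclude a
   repeated choice. *)
split=> //; apply/eqP => r0.
have := imax i0; rewrite r0 vnorm0 => /(lt_le_trans low).
apply/negP; rewrite -leNgt.
have tau0 : 0 < tau by apply: le_lt_trans (noiselt i); exact: vnorm_ge0.
have k0 : 0 <= k%:R * (d%:R * mu * E) by rewrite mulr_ge0.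
have : 0 <= (1 - (d%:R - 1) * nu) * E - (k%:R - 1) * (d%:R * mu * E) - 2 * tau by lra.
lra.
Qed.

(** The alternative accommodates supports of fewer than [k] blocks: once the support is covered,
    nothing more is asked of the choices; until then the [l] choices are distinct elements of the
    support. *)
Lemma bomp_invariant x (noise : 'cV[R]_L) tau idx xs l :
  (#|bsupp x| <= k)%N ->
  (forall i, vnorm ((Dblk D i)^T *m noise) < tau) ->
  0 < 1 - (d%:R - 1) * nu - (2 * k%:R - 1) * d%:R * mu ->
  2 * tau <= (1 - (d%:R - 1) * nu - (2 * k%:R - 1) * d%:R * mu) * xmin x ->
  bomp_run D (D *m x + noise) k idx xs -> (l <= k)%N ->
  [/\ bsupp (xs l) \subset selected idx l,
      forall i, i \in selected idx l ->
        (Dblk D i)^T *m (D *m x + noise - D *m xs l) = 0 &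
      bsupp x \subset selected idx l \/
      selected idx l \subset bsupp x /\ #|selected idx l| = l].
Proof.
move=> Sk noiselt kap0 hxm [xs0 run]; elim: l => [_|l IH lk].
  rewrite selected0 cards0; split; last by right; rewrite finset.sub0set.
    apply/fintype.subsetP => i; rewrite !inE xs0 => /negP[].
    by apply/eqP/colP => j; rewrite !mxE.
  by move=> i; rewrite inE.
have [xsl orth inv] := IH (ltnW lk); have [imax ls] := run l lk.
split; [exact: (proj1 ls)|by move=> i /(ls_normal_eq ls)|].
rewrite selectedS; case: inv => [Ssel|[selS cardl]].
  by left; apply: fintype.subset_trans Ssel _; exact: finset.subsetUr.
have [Ssel|/fintype.subsetPn[i1 i1S i1n]] := boolP (bsupp x \subset selected idx l).
  by left; apply: fintype.subset_trans Ssel _; exact: finset.subsetUr.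
right.
have res : D *m x + noise - D *m xs l = D *m (x - xs l) + noise.
  by rewrite mulmxBr addrAC.
have eS : bsupp (x - xs l) \subset bsupp x.
  rewrite -scaleN1r; apply: bsuppD => //; apply: bsuppZ.
  exact: fintype.subset_trans xsl selS.
(* A support block not yet selected is untouched by [xs l], so its error is the whole block of
   [x]. *)
have e1 : xmin x <= vnorm (blk (x - xs l) i1).
  by rewrite blkD blkN (blk_out xsl i1n) subr0 xmin_le.
rewrite res in imax orth.
have [iS r0] := greedy_step Sk eS noiselt kap0 hxm i1S e1 imax.
split; first by rewrite finset.subUset finset.sub1set iS.
rewrite cardsU1 cardl; suff -> : idx l \notin selected idx l by [].
by apply/negP => /orth; move/eqP; rewrite (negbTE r0).
Qed.

(** On the selected blocks the normal equations identify the correlations of [D h] with those of the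
    noise. Hence [|D h|^2 <= tau sqrt(k) |h|], while [quad_ge] bounds [|D h|^2] below by
    [c |h|^2]. *)
Lemma bomp_guarantee x (noise : 'cV[R]_L) tau idx xs :
  (#|bsupp x| <= k)%N -> x != 0 ->
  (forall i, vnorm ((Dblk D i)^T *m noise) < tau) ->
  0 < tau ->
  2 * tau <= (1 - (d%:R - 1) * nu - (2 * k%:R - 1) * d%:R * mu) * xmin x ->
  bomp_run D (D *m x + noise) k idx xs ->
  bsupp x \subset selected idx k /\
  vnorm (xs k - x) ^+ 2
    <= k%:R * tau ^+ 2 / (1 - (d%:R - 1) * nu - (k%:R - 1) * d%:R * mu) ^+ 2.
Proof.
move=> Sk x0 noiselt tau0 hxm run.
set kap := 1 - _ - _ in hxm.
(* The product [kap * xmin x] is at least [2 tau > 0] and [xmin x] is nonnegative. *)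
have kap0 : 0 < kap.
  have : 0 < kap * xmin x by apply: lt_le_trans hxm; rewrite mulr_gt0.
  rewrite !ltNge => /negP h; apply/negP => kap_le0; apply: h.
  by rewrite mulr_le0_ge0// xmin_ge0.
have [xsk orth inv] := bomp_invariant Sk noiselt kap0 hxm run (leqnn k).
have Ssel : bsupp x \subset selected idx k.
  case: inv => // -[selS cardk].
  (* [k] distinct elements inside a set of at most [k] elements fill it. *)
  suff -> : selected idx k = bsupp x by [].
  by apply/eqP; rewrite eqEcard selS cardk.
split => //.
set I := selected idx k in xsk orth Ssel *; set h := xs k - x.
have hI : bsupp h \subset I.
  by rewrite /h -scaleN1r; apply: bsuppD => //; exact: bsuppZ.
have k1 : (0 < k)%N.
  by have [i iS] := bsupp0P x0; apply: leq_trans Sk; apply/card_gt0P; exists i.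
set c := 1 - _ - _.
(* [c] has [k - 1] where [kap] has [2 k - 1], so [c >= kap]. *)
have c0 : 0 < c.
  apply: lt_le_trans kap0 _; rewrite lerD2l lerN2 -!mulrA ler_wpM2r//.
    by rewrite mulr_ge0// block_coherence_ge0.
  by rewrite lerD2r ler_peMl ?ler1n.
have quad := quad_ge d0 unitD hI (card_selected idx k).
have Dh : vnorm (D *m h) ^+ 2 = \sum_(i in I) dot ((Dblk D i)^T *m noise) (blk h i).
  rewrite sqr_vnorm {2}(mulmx_blocks_in D hI) dot_sumr; apply: eq_bigr => i iI.
  rewrite -dot_mulmx; congr dot; apply/eqP; rewrite -subr_eq0 -mulmxBr.
  rewrite -oppr_eq0 -mulmxN opprB -(orth i iI) /h (mulmxBr D) opprB addrA.
  by rewrite (addrC noise).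
have bound : c * vnorm h ^+ 2 <= tau * \sum_(i in I) vnorm (blk h i).
  apply: le_trans quad _; rewrite Dh mulr_sumr; apply: ler_sum => i _.
  apply: le_trans (cauchy_schwarz _ _) _; apply: ler_wpM2r; first exact: vnorm_ge0.
  exact/ltW.
have sq : (\sum_(i in I) vnorm (blk h i)) ^+ 2 <= k%:R * vnorm h ^+ 2.
  apply: le_trans (sqr_sum_le _ _) _.
  have -> : vnorm h ^+ 2 = \sum_(i in I) vnorm (blk h i) ^+ 2.
    by rewrite sqr_vnorm (dot_blocks_in _ hI); apply: eq_bigr => i _; rewrite sqr_vnorm.
  apply: ler_wpM2r; first by apply: sumr_ge0 => i _; exact: sqr_ge0.
  by rewrite ler_nat card_selected.
have [h0|h0] := eqVneq (vnorm h) 0.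
  rewrite h0 expr0n /=; apply: divr_ge0; last exact: sqr_ge0.
  by rewrite mulr_ge0 // sqr_ge0.
have hp : 0 < vnorm h ^+ 2 by rewrite exprn_gt0// lt_def h0 vnorm_ge0.
rewrite ler_pdivlMr ?exprn_gt0// -(ler_pM2r hp).
set H := vnorm h ^+ 2 in hp bound sq *.
set Sg := \sum_(_ in _) _ in bound sq.
have Sg0 : 0 <= Sg by apply: sumr_ge0 => i _; exact: vnorm_ge0.
have : (c * H) ^+ 2 <= (tau * Sg) ^+ 2.
  by rewrite ler_sqr// nnegrE mulr_ge0// ltW.
move=> h1; have h2 : tau ^+ 2 * Sg ^+ 2 <= tau ^+ 2 * (k%:R * H).
  by rewrite ler_wpM2l// sqr_ge0.
have e1 : H * c ^+ 2 * H = (c * H) ^+ 2 by ring.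
by rewrite e1; apply: le_trans h1 _; rewrite exprMn; apply: le_trans h2 _; rewrite mulrCA mulrA.
Qed.

End Greedy.

(** * Rotation invariance of the Gaussian law *)

Section Rotation.
Context {R : realType}.
Notation leb := (@lebesgue_measure R).
Local Open Scope ereal_scope.

(** Lebesgue measure is determined by its values on half-open intervals, so it equals its image
    under a translation. *)
Lemma integral_translate (a : R) (f : R -> \bar R) :
  measurable_fun setT f -> (forall x, 0 <= f x) ->
  \int[leb]_x f (x + a)%R = \int[leb]_x f x.
Proof.
move=> mf f0.
pose phi (x : measurableTypeR R) : measurableTypeR R := (x + a)%R.
have mphi : measurable_fun setT phi by exact: measurable_funD.
transitivity (\int[pushforward leb phi]_x f x).
  by rewrite (ge0_integral_pushforward mphi)// => x _; exact: f0.
apply: eq_measure_integral => //= A mA _.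
apply/esym; apply: lebesgue_measure_unique => //= X [[x y] xy <-].
have -> : pushforward leb phi `]x, y]%classic = leb `](x - a)%R, (y - a)%R]%classic.
  congr (leb _); apply/seteqP; split => z /=; rewrite /phi !in_itv /=.
    by rewrite ltrBlDr lerBrDr.
  by rewrite ltrBlDr lerBrDr.
rewrite !lebesgue_measure_itv/= !lte_fin ltrD2r; case: ifP => // _.
by rewrite -!EFinB; congr (_%:E); ring.
Qed.

Definition plane_integral (f : R * R -> \bar R) := \int[leb]_x \int[leb]_y f (x, y).

(** Tonelli puts the integral in [x] innermost, where for fixed [y] the shear is the translation by
    [a y]. *)
Lemma plane_integral_shear1 (a : R) (f : R * R -> \bar R) :
  measurable_fun setT f -> (forall z, 0 <= f z) ->
  plane_integral (fun z => f (z.1 + a * z.2, z.2)%R) = plane_integral f.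
Proof.
move=> mf f0.
have mS : measurable_fun setT (fun z : R * R => (z.1 + a * z.2, z.2)%R).
  apply: measurable_fun_pair => //; apply: measurable_funD => //.
  exact: measurable_funM.
set g := (fun z => _).
have mg : measurable_fun setT g by exact: measurableT_comp.
have g0 z : 0 <= g z by exact: f0.
have swap (h : R * R -> \bar R) : measurable_fun setT h -> (forall z, 0 <= h z) ->
    plane_integral h = \int[leb]_y \int[leb]_x h (x, y).
  exact: (@fubini_tonelli _ _ _ _ R leb leb h).
rewrite (swap g mg g0) (swap f mf f0); apply: eq_integral => y _ /=.
rewrite (@integral_translate (a * y)%R (fun x => f (x, y)))//.
exact: measurableT_comp.
Qed.

Lemma plane_integral_shear2 (b : R) (f : R * R -> \bar R) :
  measurable_fun setT f -> (forall z, 0 <= f z) ->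
  plane_integral (fun z => f (z.1, z.2 + b * z.1)%R) = plane_integral f.
Proof.
move=> mf f0; apply: eq_integral => x _ /=.
rewrite (@integral_translate (b * x)%R (fun y => f (x, y)))//.
exact: measurableT_comp.
Qed.

Definition rot (c s : R) (z : R * R) : R * R :=
  (c * z.1 + s * z.2, - s * z.1 + c * z.2)%R.

Lemma measurable_rot c s : measurable_fun setT (rot c s).
Proof.
by apply: measurable_fun_pair; apply: measurable_funD; exact: measurable_funM.
Qed.

(* A rotation of angle in ]-pi, pi[ is a product of three shears. *)
Lemma plane_integral_rot (c s : R) (f : R * R -> \bar R) :
  (c ^+ 2 + s ^+ 2 = 1)%R -> (0 <= c)%R ->
  measurable_fun setT f -> (forall z, 0 <= f z) ->
  plane_integral (f \o rot c s) = plane_integral f.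
Proof.
(* [a] is the tangent of half the rotation angle; [0 <= c] makes its denominator positive. *)
move=> cs c0 mf f0; pose a : R := (s / (1 + c))%R.
have c1 : (1 + c != 0)%R by rewrite gt_eqF// ltr_pwDl.
have ac : (a * (1 + c) = s)%R by rewrite /a divfK.
have as_ : (1 - a * s = c)%R.
  apply: (mulIf c1); rewrite mulrBl mulrAC ac; move: cs; nra.
have mS1 : measurable_fun setT (fun z : R * R => (z.1 + a * z.2, z.2)%R).
  apply: measurable_fun_pair => //; apply: measurable_funD => //.
  exact: measurable_funM.
have mS2 : measurable_fun setT (fun z : R * R => (z.1, z.2 + - s * z.1)%R).
  apply: measurable_fun_pair => //; apply: measurable_funD => //.
  exact: measurable_funM.
rewrite -[RHS](plane_integral_shear1 a mf f0).
set f1 := (fun z => _); have mf1 : measurable_fun setT f1 by exact: measurableT_comp.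
have f10 z : 0 <= f1 z by exact: f0.
rewrite -[RHS](plane_integral_shear2 (- s) mf1 f10).
set f2 := (fun z => _); have mf2 : measurable_fun setT f2 by exact: measurableT_comp.
have f20 z : 0 <= f2 z by exact: f0.
rewrite -[RHS](plane_integral_shear1 a mf2 f20).
congr plane_integral; apply/funext => -[x y]; rewrite /f2 /f1 /rot /=.
congr (f (_, _)); last by rewrite -as_; ring.
by rewrite -{1}as_ -{2}ac -as_; ring.
Qed.

(** Change of variables involves the Radon-Nikodym derivative; it agrees almost everywhere with the
    Gaussian density because both have the same integral over every measurable set. *)
Lemma integral_normal_prob (sg : R) (f : R -> \bar R) : measurable_fun setT f ->
  (forall x, 0 <= f x) ->
  \int[normal_prob 0 sg]_x f x = \int[leb]_x (f x * (normal_pdf 0 sg x)%:E).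
Proof.
move=> mf f0.
have dom := normal_prob_dominates (0 : R) sg.
rewrite -(Radon_Nikodym_SigmaFinite.change_of_variables dom)//.
apply: ae_eq_integral => //.
- apply: emeasurable_funM => //.
  exact: measurable_int (Radon_Nikodym_SigmaFinite.f_integrable dom).
- apply: emeasurable_funM => //; apply/measurable_EFinP; exact: measurable_normal_pdf.
apply: ae_eqe_mul2l; apply: integral_ae_eq => //.
- exact: Radon_Nikodym_SigmaFinite.f_integrable.
- apply/measurable_EFinP; exact: measurable_normal_pdf.
- by move=> A _ mA; rewrite -Radon_Nikodym_SigmaFinite.f_integral.
Qed.

Lemma normal_pdf_rot (c s sg x y : R) : (c ^+ 2 + s ^+ 2 = 1)%R -> sg != 0%R ->
  (normal_pdf 0 sg (c * x + s * y) * normal_pdf 0 sg (- s * x + c * y)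
   = normal_pdf 0 sg x * normal_pdf 0 sg y)%R.
Proof.
move=> cs sg0.
have pdf2 u v : (normal_pdf 0 sg u * normal_pdf 0 sg v =
    normal_peak sg ^+ 2 * expR (- (u ^+ 2 + v ^+ 2) / (sg ^+ 2 *+ 2)))%R.
  rewrite normal_pdfE// /normal_fun !subr0 opprD mulrDl expRD.
  by rewrite mulrACA -expr2.
rewrite !pdf2 (_ : (c * x + s * y) ^+ 2 + (- s * x + c * y) ^+ 2 =
  (c ^+ 2 + s ^+ 2) * (x ^+ 2 + y ^+ 2))%R; last by ring.
by rewrite cs mul1r.
Qed.

End Rotation.

(** * Rotation invariance of the product of two normal laws *)

Section GaussProduct.
Context {R : realType}.
Notation leb := (@lebesgue_measure R).
Local Open Scope ereal_scope.

Lemma product_normal_prob (sg : R) (C : set (R * R)) : measurable C ->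
  (normal_prob 0 sg \x normal_prob 0 sg) C =
  plane_integral (fun z => (\1_C z * (normal_pdf 0 sg z.1 * normal_pdf 0 sg z.2))%:E).
Proof.
move=> mC; rewrite /product_measure1 integral_normal_prob//; last first.
  exact: measurable_fun_xsection.
apply: eq_integral => x _ /=.
have mCx : measurable (xsection C x) by exact: measurable_xsection.
have mpdf : measurable_fun setT (fun y : R => (normal_pdf 0 sg y)%:E).
  by apply/measurable_EFinP; exact: measurable_normal_pdf.
pose g := (fun y : R => (normal_pdf 0 sg y)%:E) \_ (xsection C x).
have mg : measurable_fun setT g.
  apply: (iffLR (measurable_restrictT (fun y : R => (normal_pdf 0 sg y)%:E) mCx)).
  exact: measurable_funTS.
have g0 y : 0 <= g y.
  by rewrite /g patchE; case: ifP => // _; rewrite lee_fin normal_pdf_ge0.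
rewrite {1}/normal_prob integral_mkcond -/g muleC.
rewrite -(ge0_integralZl_EFin leb measurableT (fun y _ => g0 y) mg (normal_pdf_ge0 0 sg x)).
apply: eq_integral => y _; rewrite /g patchE mem_xsection indicE.
by case: ifP => _ /=; rewrite ?mul1r ?mul0r ?mule0.
Qed.

Lemma product_normal_prob_rot (c s sg : R) (C : set (R * R)) :
  (c ^+ 2 + s ^+ 2 = 1)%R -> (0 <= c)%R -> sg != 0%R -> measurable C ->
  (normal_prob 0 sg \x normal_prob 0 sg) (rot c s @^-1` C) =
  (normal_prob 0 sg \x normal_prob 0 sg) C.
Proof.
move=> cs c0 sg0 mC.
have mrC : measurable (rot c s @^-1` C).
  by rewrite -[X in measurable X]setTI; apply: measurable_rot.
rewrite (product_normal_prob sg mrC) (product_normal_prob sg mC).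
set f := (X in _ = plane_integral X).
have mf : measurable_fun setT f.
  apply/measurable_EFinP; apply: measurable_funM; first exact: measurable_indic.
  apply: measurable_funM.
    by apply: measurableT_comp; [exact: measurable_normal_pdf|exact: measurable_fst].
  by apply: measurableT_comp; [exact: measurable_normal_pdf|exact: measurable_snd].
have f0 z : 0 <= f z.
  by rewrite lee_fin mulr_ge0// mulr_ge0 ?normal_pdf_ge0.
rewrite -(plane_integral_rot cs c0 mf f0).
congr plane_integral; apply/funext => -[x y].
by rewrite /f /= normal_pdf_rot.
Qed.

End GaussProduct.

(** * Joint law of two variables relative to an event *)

Section JointLaw.
Context {R : realType} {dT : measure_display} {T : measurableType dT}.
Variable P : probability T R.
Local Open Scope ereal_scope.

(** The image under [(X, Y)] of the conditional probability given [E] agrees with [m1 \x m2] on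
    rectangles, hence everywhere; a null [E] is trivial. In use, [E] fixes a box for the remaining
    coordinates. *)
Lemma joint_law (m1 m2 : probability (measurableTypeR R) R) (X Y : T -> R) (E : set T) :
  measurable_fun setT X -> measurable_fun setT Y -> measurable E ->
  (forall A B : set R, measurable A -> measurable B ->
     P (X @^-1` A `&` Y @^-1` B `&` E) = m1 A * m2 B * P E) ->
  forall C : set (R * R), measurable C ->
    P ((fun t => (X t, Y t)) @^-1` C `&` E) = (m1 \x m2) C * P E.
Proof.
move=> mX mY mE indep C mC.
have mXY : measurable_fun setT (fun t => (X t, Y t)) by exact: measurable_fun_pair.
have mXYC : measurable ((fun t => (X t, Y t)) @^-1` C).
  by rewrite -[X in measurable X]setTI; apply: mXY.
have [PE0|PE0] := eqVneq (P E) 0.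
  rewrite PE0 mule0; apply/eqP; rewrite eq_le measure_ge0 andbT -PE0.
  by apply: le_measure; rewrite ?inE//; exact: measurableI.
have PEfin : P E \is a fin_num by exact: fin_num_measure.
have PEp : (0 < fine (P E))%R.
  by rewrite fine_gt0// lt0e PE0 measure_ge0 ltey_eq PEfin.
have k0 : (0 <= (fine (P E))^-1)%R by rewrite invr_ge0 ltW.
have kPE : (fine (P E))^-1%:E * P E = 1.
  by rewrite -[X in _ * X]fineK// -EFinM mulVf// gt_eqF.
pose XY t : measurableTypeR R * measurableTypeR R := (X t, Y t).
have mXY' : measurable_fun setT XY by exact: measurable_fun_pair.
have uniq := @product_measure_unique _ _ _ _ R m1 m2
  (mscale (NngNum k0) (pushforward (mrestr P mE) XY)).
rewrite (uniq mXY' _ C mC) => [|A B mA mB]; last first.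
  have <- : (fine (P E))^-1%:E * P (X @^-1` A `&` Y @^-1` B `&` E) = m1 A * m2 B.
    by rewrite indep// muleCA kPE mule1.
  by [].
by rewrite /mscale/= muleC muleA (muleC (P E)) kPE mul1e.
Qed.

End JointLaw.

(** * Independent standard normal families and plane rotations *)

Section IidNormal.
Context {R : realType} {dT : measure_display} {T : measurableType dT}.
Variables (P : probability T R) (L : nat).
Implicit Types (u : 'I_L -> T -> R).

(** One formula encodes both independence and standard normal marginals; taking some [B r] to be the
    whole line gives every subfamily. *)
Definition iid_normal u :=
  (forall r, measurable_fun setT (u r)) /\
  forall B : 'I_L -> set R, (forall r, measurable (B r)) ->
    P [set t | forall r, B r (u r t)] = (\prod_(r < L) normal_prob 0 1 (B r))%E.

Lemma measurable_forall_in u (Q : pred 'I_L) (B : 'I_L -> set R) :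
  (forall r, measurable_fun setT (u r)) -> (forall r, measurable (B r)) ->
  measurable [set t | forall r, Q r -> B r (u r t)].
Proof.
move=> mu mB.
have -> : [set t | forall r, Q r -> B r (u r t)] =
    \bigcap_(r in [set r | Q r]) (u r @^-1` B r).
  by apply/seteqP; split => t h r; exact: h.
apply: fin_bigcap_measurable => [|r _]; first exact: finite_finset.
by rewrite -[X in measurable X]setTI; apply: mu.
Qed.

Lemma iid_normal_sub u (Q : pred 'I_L) (B : 'I_L -> set R) :
  iid_normal u -> (forall r, measurable (B r)) ->
  P [set t | forall r, Q r -> B r (u r t)] = (\prod_(r < L | Q r) normal_prob 0 1 (B r))%E.
Proof.
move=> [mu iid] mB; pose B' r := if Q r then B r else setT.
have -> : [set t | forall r, Q r -> B r (u r t)] = [set t | forall r, B' r (u r t)].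
  apply/seteqP; split => t /= h r; rewrite /B'; first by case: ifPn => // /h.
  by move=> Qr; have := h r; rewrite /B' Qr.
rewrite iid => [|r]; last by rewrite /B'; case: ifP.
rewrite [RHS]big_mkcond; apply: eq_bigr => r _; rewrite /B'; case: ifP => // _.
exact: probability_setT.
Qed.


Definition givens (i j : 'I_L) (c s : R) (a : 'I_L -> R) (r : 'I_L) : R :=
  if r == i then c * a i + s * a j else if r == j then - s * a i + c * a j else a r.

Lemma givens_dot i j c s a b : i != j -> c ^+ 2 + s ^+ 2 = 1 ->
  \sum_r givens i j c s a r * givens i j c s b r = \sum_r a r * b r.
Proof.
move=> ij cs; rewrite (bigD1 i)// (bigD1 j) 1?eq_sym//=.
rewrite [RHS](bigD1 i)// [X in _ = _ + X](bigD1 j) 1?eq_sym//=.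
rewrite (eq_bigr (fun r => a r * b r)) => [|r /andP[ri rj]]; last first.
  by rewrite /givens (negbTE ri) (negbTE rj).
rewrite /givens !eqxx eq_sym (negbTE ij) !addrA; congr (_ + _).
transitivity ((c ^+ 2 + s ^+ 2) * (a i * b i + a j * b j)); first by ring.
by rewrite cs mul1r.
Qed.

(** Only coordinates [i] and [j] change. Relative to the box event [E] on the others, the pair has
    the product law, which the rotation preserves. *)
Lemma iid_normal_givens u i j c s : iid_normal u -> i != j ->
  c ^+ 2 + s ^+ 2 = 1 -> 0 <= c ->
  iid_normal (fun r t => givens i j c s (u^~ t) r).
Proof.
move=> iidu ij cs c0; have [mu iid] := iidu.
have ji : (j == i) = false by rewrite eq_sym (negbTE ij).
split.
  move=> r; rewrite /givens; case: (r == i); last case: (r == j) => //;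
    by apply: measurable_funD; apply: measurable_funM => //; exact: measurable_cst.
move=> B mB.
pose Q r := (r != i) && (r != j).
pose E := [set t | forall r, Q r -> B r (u r t)].
have mE : measurable E by exact: measurable_forall_in.
have PE : P E = (\prod_(r < L | Q r) normal_prob 0 1 (B r))%E by exact: iid_normal_sub.
have -> : [set t | forall r, B r (givens i j c s (u^~ t) r)] =
    (fun t => (u i t, u j t)) @^-1` (rot c s @^-1` (B i `*` B j)) `&` E.
  apply/seteqP; split => t /=.
    move=> h; split; last first.
      by move=> r /andP[ri rj]; have := h r; rewrite /givens (negbTE ri) (negbTE rj).
    by have := h i; have := h j; rewrite /givens !eqxx ji.
  move=> [[hi hj] h] r; rewrite /givens.
  case: (eqVneq r i) => [->//|ri]; case: (eqVneq r j) => [->//|rj].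
  by apply: h; rewrite /Q ri rj.
have mBij : measurable (B i `*` B j) by exact: measurableX.
rewrite (@joint_law _ _ _ P (normal_prob 0 1) (normal_prob 0 1) (u i) (u j) E)//.
- rewrite (product_normal_prob_rot cs c0 (oner_neq0 _) mBij).
  rewrite (@product_measure1E _ _ _ _ R (normal_prob 0 1) (normal_prob 0 1)
    _ _ (mB i) (mB j)) PE [RHS](bigD1 i)// [X in _ = (_ * X)%E](bigD1 j) 1?eq_sym//=.
  by rewrite muleA.
- move=> A A' mA mA'.
  pose B' r := if r == i then A else if r == j then A' else B r.
  have -> : u i @^-1` A `&` u j @^-1` A' `&` E = [set t | forall r, B' r (u r t)].
    apply/seteqP; split => t /=.
      move=> [[hi hj] h] r; rewrite /B'.
      case: (eqVneq r i) => [->//|ri]; case: (eqVneq r j) => [->//|rj].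
      by apply: h; rewrite /Q ri rj.
    move=> h; have := h i; have := h j; rewrite /B' !eqxx ji => hj hi.
    split => // r /andP[ri rj].
    by have := h r; rewrite /B' (negbTE ri) (negbTE rj).
  rewrite iid => [|r]; last by rewrite /B'; case: ifP => // _; case: ifP.
  rewrite PE (bigD1 i)// (bigD1 j) 1?eq_sym//= /B' !eqxx ji muleA.
  congr (_ * _)%E; apply: eq_bigr => r /andP[ri rj].
  by rewrite (negbTE ri) (negbTE rj).
- by rewrite -[X in measurable X]setTI; apply: measurable_rot.
Qed.

End IidNormal.

(** * Reduction of one block to at most d rows *)

Section Triangularize.
Context {R : realType} {dT : measure_display} {T : measurableType dT}.
Variables (P : probability T R) (L d : nat).
Implicit Types (u : 'I_L -> T -> R) (A : 'I_L -> 'I_d -> R).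

(** With [A] seen as a matrix, these are [A^T u] at each outcome, which is the noise to be bounded,
    and the Gram matrix [A^T A], which is all that Gershgorin's bound uses. *)
Definition same_products u A u' A' :=
  (forall t j, \sum_r A' r j * u' r t = \sum_r A r j * u r t) /\
  (forall j j', \sum_r A' r j * A' r j' = \sum_r A r j * A r j').

Lemma same_products_trans u A u1 A1 u2 A2 :
  same_products u A u1 A1 -> same_products u1 A1 u2 A2 -> same_products u A u2 A2.
Proof.
move=> [h1 k1] [h2 k2]; split=> [t j|j j']; first by rewrite h2 h1.
by rewrite k2 k1.
Qed.

(* A plane rotation of rows i and j of A sends (p, q) = (A i l, A j l) to (|p| / p h, 0)
   with h = sqrt (p^2 + q^2); this sign makes its cosine nonnegative. *)
Lemma eliminate_column u A l (K : {set 'I_L}) : iid_normal P u ->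
  exists u' A' (K' : {set 'I_L}),
    [/\ iid_normal P u', same_products u A u' A', (#|K'| <= #|K|.+1)%N, K \subset K' &
      [/\ forall r, r \notin K' -> A' r l = 0 &
      forall l', (forall r, r \notin K -> A r l' = 0) ->
                 (forall r, r \notin K' -> A' r l' = 0)]].
Proof.
pose bad A1 := [set r | (r \notin K) && (A1 r l != 0)]%SET.
(* Induction on the number of nonzero entries of column [l] in rows outside [K]; a last such row is
   simply added to [K]. *)
have [m] := ubnP #|bad A|; elim: m u A => // m IH u A.
rewrite ltnS; set Z := bad A => Zm iidu.
have [Z1|Z1] := leqP #|Z| 1.
  exists u, A, (K :|: Z); split=> //.
  - by apply: leq_trans (leq_card_setU _ _) _; rewrite -addn1 leq_add2l.
  - exact: finset.subsetUl.
  - split=> [r|l' h r]; rewrite !inE !negb_or.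
      by move=> /andP[rK]; rewrite rK negbK => /eqP.
    by move=> /andP[rK _]; exact: h.
have /card_gt1P[i [j [iZ jZ ij]]] := Z1.
move: (iZ) (jZ); rewrite !inE => /andP[iK Ai0] /andP[jK Aj0].
pose p := A i l; pose q := A j l; pose h := Num.sqrt (p ^+ 2 + q ^+ 2).
have p2 : 0 < p ^+ 2 by rewrite exprn_even_gt0.
have h2 : h ^+ 2 = p ^+ 2 + q ^+ 2.
  by rewrite sqr_sqrtr// addr_ge0// sqr_ge0.
have h0 : 0 < h by rewrite sqrtr_gt0 ltr_wpDr// sqr_ge0.
pose e := Num.sg p.
have ep : e * p = `|p| by rewrite -normrEsg.
have e2 : e ^+ 2 = 1 by rewrite sqr_sg Ai0.
pose c := `|p| / h; pose s := e * q / h.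
have c0 : 0 <= c by rewrite divr_ge0// ltW.
have cs : c ^+ 2 + s ^+ 2 = 1.
  rewrite /c /s !expr_div_n exprMn e2 mul1r real_normK ?num_real// -mulrDl -h2.
  by rewrite divff// expf_neq0// gt_eqF.
have ji : (j == i) = false by rewrite eq_sym (negbTE ij).
pose u1 r t := givens i j c s (u^~ t) r.
pose A1 r l' := givens i j c s (A^~ l') r.
have A1j : A1 j l = 0.
  by rewrite /A1 /givens ji eqxx /c /s -ep -/p -/q; ring.
have A1r r l' : r != i -> r != j -> A1 r l' = A r l'.
  by move=> ri rj; rewrite /A1 /givens (negbTE ri) (negbTE rj).
have same1 : same_products u A u1 A1 by split => *; rewrite givens_dot.
have [|u' [A' [K' [iid' same' K'K KK' [col' keep']]]]] := IH u1 A1 _ (iid_normal_givens iidu ij cs c0).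
  apply: leq_trans Zm; apply: proper_card; apply/properP; split.
    apply/fintype.subsetP => r; rewrite !inE => /andP[rK A1r0]; rewrite rK /=.
    have [->//|ri] := eqVneq r i; have [->//|rj] := eqVneq r j.
    by rewrite -A1r.
  by exists j => //; rewrite !inE A1j eqxx andbF.
exists u', A', K'; split=> //; first exact: same_products_trans same'.
(* The rotated rows lie outside [K], where a column supported in [K] has only zeros, so columns
   already treated are not disturbed. *)
split=> // l' hl'; apply: keep' => r rK; rewrite /A1 /givens !hl'//.
by rewrite !mulr0 addr0; case: ifP => // _; case: ifP.
Qed.

Lemma triangularize u A : iid_normal P u ->
  exists u' A' (K : {set 'I_L}),
    [/\ iid_normal P u', same_products u A u' A', (#|K| <= d)%N &
      forall r l, r \notin K -> A' r l = 0].
Proof.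
move=> iidu.
have step n : (n <= d)%N -> exists u' A' (K : {set 'I_L}),
    [/\ iid_normal P u', same_products u A u' A', (#|K| <= n)%N &
      forall l : 'I_d, (l < n)%N -> forall r, r \notin K -> A' r l = 0].
  elim: n => [_|n IH nd]; first by exists u, A, finset.set0; rewrite cards0; split.
  have [u1 [A1 [K1 [iid1 same1 K1n h1]]]] := IH (ltnW nd).
  have [u2 [A2 [K2 [iid2 same2 K2n K12 [col keep]]]]] :=
    eliminate_column A1 (Ordinal nd) K1 iid1.
  exists u2, A2, K2; split=> //; first exact: same_products_trans same2.
    exact: leq_trans K2n _.
  move=> l; rewrite ltnS leq_eqVlt => /orP[/eqP ln|ln].
    by have -> : l = Ordinal nd by exact: val_inj.
  by apply: keep => r; exact: h1.
have [u' [A' [K [iid' same' Kd h]]]] := step d (leqnn d).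
by exists u', A', K; split=> // r l; apply: h.
Qed.

End Triangularize.

(** * Sums of squares of Gaussian variables *)

Section SumOfSquares.
Context {R : realType} {dT : measure_display} {T : measurableType dT}.
Variables (P : probability T R) (L : nat) (u : 'I_L -> T -> R).
Hypothesis iidu : iid_normal P u.
(** [G n] is to dominate the tail of a sum of [n] squares. Keeping it abstract isolates the analysis
    in [GS], the addition of one independent square to an arbitrary law [m]. *)
Variable G : nat -> R -> R.
Hypothesis G0 : forall s, 0 < s -> 0 <= G 0 s.
Hypothesis GS : forall n (m : probability (measurableTypeR R) R),
  (forall s, 0 < s -> (m `[s, +oo[%classic <= (G n s)%:E)%E) ->
  forall s, 0 < s ->
    ((m \x normal_prob 0 1) [set z : R * R | s <= z.1 + z.2 ^+ 2]%R <= (G n.+1 s)%:E)%E.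

Let sumsq (J : {set 'I_L}) t := \sum_(r in J) u r t ^+ 2.

Lemma measurable_sumsq J : measurable_fun setT (sumsq J).
Proof.
rewrite /sumsq; under eq_fun do rewrite -big_enum /=.
by apply: measurable_sum => r; apply: measurable_funX; exact: iidu.1.
Qed.

(** The induction needs more than a tail bound: the partial sum must be independent of all
    coordinates outside [J], so that the next square can be split off as a product with its law
    [m]. *)
Lemma sumsq_law n (J : {set 'I_L}) : #|J| = n ->
  exists m : probability (measurableTypeR R) R,
    (forall s, 0 < s -> (m `[s, +oo[%classic <= (G n s)%:E)%E) /\
    forall C B, measurable C -> (forall r, measurable (B r)) ->
      P (sumsq J @^-1` C `&` [set t | forall r, r \notin J -> B r (u r t)]) =
      (m C * \prod_(r | r \notin J) normal_prob 0 1 (B r))%E.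
Proof.
elim: n J => [|n IH] J Jn.
  have J0 : J = finset.set0 by apply: cards0_eq.
  have S0 t : sumsq J t = 0 by rewrite /sumsq J0 big_set0.
  (* The empty sum has the Dirac law at 0, which gives no mass to [[s, +oo[] for [s > 0]. *)
  pose m0 : probability (measurableTypeR R) R := dirac (0 : measurableTypeR R).
  have m0E C : m0 C = ((0 : R) \in C)%:R%:E by exact: diracE.
  exists m0; split=> [s s0|C B mC mB].
    rewrite m0E memNset ?lee_fin ?G0//.
    by rewrite /= in_itv/= andbT; apply/negP; rewrite -ltNge.
  have [C0|C0] := pselect (C 0).
    rewrite -(iid_normal_sub (fun r => r \notin J) iidu mB) m0E mem_set// mul1e.
    by congr (P _); apply/seteqP; split => t /=; [case|split => //; rewrite S0].
  rewrite m0E memNset// mul0e -[RHS](measure0 P).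
  by congr (P _); apply/seteqP; split => t //= -[]; rewrite S0.
have [j jJ] : exists j, j \in J by apply/card_gt0P; rewrite Jn.
pose J' := J :\ j.
have J'n : #|J'| = n by move: Jn; rewrite (cardsD1 j) jJ => -[].
have jJ' : j \notin J' by rewrite !inE eqxx.
have SJ t : sumsq J t = sumsq J' t + u j t ^+ 2.
  by rewrite /sumsq (big_setD1 j jJ) addrC.
have [m [mtail mlaw]] := IH J' J'n.
have notJ r : (r \notin J') = (r == j) || (r \notin J).
  by rewrite !inE negb_and negbK.
have mS : @measurable_fun _ _ T (measurableTypeR R) setT (sumsq J) := measurable_sumsq J.
pose mfS : {mfun T >-> measurableTypeR R} :=
  HB.pack (sumsq J) (isMeasurableFun.Build _ _ _ _ _ mS).
pose f (z : R * R) := z.1 + z.2 ^+ 2.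
have mf : measurable_fun setT f.
  by apply: measurable_funD => //; apply: measurable_funX.
have law C B : measurable C -> (forall r, measurable (B r)) ->
  P (sumsq J @^-1` C `&` [set t | forall r, r \notin J -> B r (u r t)]) =
  ((m \x normal_prob 0 1) (f @^-1` C) * \prod_(r | r \notin J) normal_prob 0 1 (B r))%E.
  move=> mC mB; set E := [set t | _].
  have mE : measurable E.
    exact: (measurable_forall_in (fun r => r \notin J) iidu.1 mB).
  have PE : P E = (\prod_(r | r \notin J) normal_prob 0 1 (B r))%E.
    exact: (iid_normal_sub (fun r => r \notin J) iidu mB).
  have mfC : measurable (f @^-1` C) by rewrite -[X in measurable X]setTI; apply: mf.
  rewrite -PE -(joint_law (X := sumsq J') (Y := u j) _ _ mE _ mfC)//.
  - congr (P (_ `&` _)); apply/seteqP; split => t; by rewrite /= SJ.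
  - exact: measurable_sumsq.
  - exact: iidu.1.
  (* The condition on [u j] becomes one more side of the box over the coordinates outside [J']. *)
  move=> A A' mA mA'; pose B' r := if r == j then A' else B r.
  have mB' r : measurable (B' r) by rewrite /B'; case: ifP.
  have := mlaw A B' mA mB'.
  rewrite (bigD1 j)//= {2}/B' eqxx muleA PE => h.
  rewrite [X in (_ * X)%E](eq_big (fun r => (r \notin J') && (r != j)) (fun r => normal_prob 0 1 (B' r))).
  - rewrite -h; congr (P _); apply/seteqP; split => t /=.
      move=> [[SA uA] hE]; split=> // r; rewrite notJ /B'.
      by case: eqVneq => [->//|_] /= /hE.
    move=> [SA hE]; split.
      by split=> //; have := hE j jJ'; rewrite /B' eqxx.
    move=> r rJ; have := hE r; rewrite notJ rJ orbT /B'.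
    by case: eqVneq rJ => [->|_ _ /(_ isT)//]; rewrite jJ.
  - by move=> r; rewrite notJ; case: eqVneq => [->|_] //=; rewrite ?jJ ?andbT.
  - by move=> r rJ; rewrite /B'; case: eqVneq rJ => // ->; rewrite jJ.
pose m1 : probability (measurableTypeR R) R := distribution P mfS.
exists m1.
have lawS C : measurable C -> m1 C = (m \x normal_prob 0 1)%E (f @^-1` C).
  move=> mC; have := law C (fun=> setT) mC (fun=> measurableT).
  rewrite big1 => [|r _]; last exact: probability_setT.
  rewrite mule1 => <-; congr (P _).
  by rewrite (_ : [set t | _] = setT) ?setIT//; apply/seteqP; split.
split=> [s s0|C B mC mB]; last by rewrite law// lawS.
rewrite lawS//.
rewrite (_ : f @^-1` _ = [set z : R * R | s <= z.1 + z.2 ^+ 2]); first exact: GS.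
by apply/seteqP; split => z; rewrite /= in_itv/= andbT.
Qed.

Lemma sumsq_tail (J : {set 'I_L}) s : 0 < s ->
  (P [set t | (s <= \sum_(r in J) u r t ^+ 2)%R] <= (G #|J| s)%:E)%E.
Proof.
move=> s0; have [m [mtail mlaw]] := sumsq_law (erefl #|J|).
apply: le_trans (mtail s s0).
have := mlaw `[s, +oo[%classic (fun=> setT) (measurable_itv _) (fun=> measurableT).
rewrite big1 => [|r _]; last exact: probability_setT.
rewrite mule1 => <-; rewrite le_eqVlt; apply/orP; left; apply/eqP; congr (P _).
by apply/seteqP; split => t /=; rewrite in_itv/= andbT //; case.
Qed.

End SumOfSquares.

(** * A numerical bound on the peak of the normal density *)

Section GaussianPeak.
Context {R : realType}.

Lemma sin_le_id (x : R) : 0 <= x -> sin x <= x.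
Proof.
rewrite le_eqVlt => /predU1P[<-|x0]; first by rewrite sin0.
have csin : {within `[0, x], continuous (@sin R)}.
  by apply: continuous_subspaceT => y; exact: continuous_sin.
have [c _] := MVT x0 (fun y _ => is_derive_sin y) csin.
by rewrite sin0 !subr0 => ->; rewrite ler_piMl ?cos_le1// ltW.
Qed.

(** From [cos x = 1 - 2 sin(x / 2)^2] and [0 < sin(x / 2) <= x / 2]. *)
Lemma cos_quadratic_ge (x : R) : 0 < x < 4 -> 1 - x ^+ 2 / 2 <= cos x.
Proof.
move=> /andP[x0 x4]; have y0 : 0 <= x / 2 by lra.
have := sin_le_id y0; have : 0 < sin (x / 2) by apply: sin2_gt0; lra.
have e : x / 2 *+ 2 = x by rewrite -mulr_natr divfK.
rewrite -[in X in _ -> _ -> _ <= X]e cos_mulr2n cos2sin2; nra.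
Qed.

Lemma cos_double_ge (x c : R) : 0 <= c -> c <= cos x -> 2 * c ^+ 2 - 1 <= cos (2 * x).
Proof.
by move=> c0 cx; rewrite (_ : 2 * x = x *+ 2) ?cos_mulr2n; [nra|rewrite mulr_natl].
Qed.

(* cos (25 / 16) > 0, by doubling the angle 25 / 256 four times *)
Lemma pi_gt : 25 / 8 < pi :> R.
Proof.
have double (x c c' : R) : 0 <= c -> c <= cos x -> c' <= 2 * c ^+ 2 - 1 -> c' <= cos (2 * x).
  by move=> c0 cx h; apply: le_trans h (cos_double_ge c0 cx).
(* Each fraction is a convenient rational below [2 c^2 - 1] for the previous fraction [c]; the first
   is below [1 - x^2 / 2]. *)
have h0 : 208 / 209 <= cos (25 / 256 : R).
  apply: le_trans (cos_quadratic_ge _); lra.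
have h1 : 513 / 523 <= cos (2 * (25 / 256) : R) by apply: double h0 _; lra.
have h2 : 61 / 66 <= cos (2 * (2 * (25 / 256)) : R) by apply: double h1 _; lra.
have h3 : 17 / 24 <= cos (2 * (2 * (2 * (25 / 256))) : R).
  by apply: double h2 _; lra.
have h4 : 1 / 1000 <= cos (2 * (2 * (2 * (2 * (25 / 256)))) : R).
  by apply: double h3 _; lra.
rewrite ltNge; apply/negP => pile.
have pi2 := pi_ge2 R.
have : ~ cos (2 * (2 * (2 * (2 * (25 / 256))))) <= cos (pi / 2) :> R.
  by apply/negP; rewrite -ltNge cos_pihalf; lra.
by apply; rewrite leNgt ltr_cos ?in_itv/=; lra.
Qed.

Lemma normal_peak1_gt0 : 0 < normal_peak 1 :> R.
Proof. by rewrite normal_peak_gt0// oner_neq0. Qed.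

(** The peak is [1 / sqrt(2 pi)], so the claim is equivalent to [2 pi > 25 / 4], that is to
    [pi_gt]. *)
Lemma normal_peak1_lt : normal_peak 1 < 2 / 5 :> R.
Proof.
rewrite /normal_peak expr1n mul1r -[ltRHS]invf_div ltf_pV2 ?posrE; last 2 first.
- by rewrite sqrtr_gt0 pmulrn_lgt0// pi_gt0.
- lra.
rewrite -(ger0_norm (_ : 0 <= 5 / 2)); last lra.
rewrite -sqrtr_sqr ltr_sqrt; last by rewrite pmulrn_lgt0// pi_gt0.
by rewrite -mulr_natr; have := pi_gt; lra.
Qed.

End GaussianPeak.

(** * Mills' ratio and integrals of even functions *)

Section GaussianTail.
Context {R : realType}.
Notation leb := (@lebesgue_measure R).
Notation peak := (@normal_peak R 1).
Local Notation gamma := (@normal_prob R 0 1).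

Lemma normal_pdf01E (x : R) : normal_pdf 0 1 x = peak * expR (- x ^+ 2 / 2).
Proof. by rewrite normal_pdfE ?oner_neq0// /normal_fun subr0 expr1n. Qed.

Lemma measurable_normal_pdf01 (A : set R) :
  measurable_fun A (fun x : R => (normal_pdf 0 1 x)%:E).
Proof. by apply/measurable_EFinP; apply: measurable_funTS; exact: measurable_normal_pdf. Qed.

(** On [[a, +oo[] the density is at most [x / a] times itself, and that product has an explicit
    antiderivative. *)
Lemma mills_ratio (a : R) : 0 < a ->
  (\int[leb]_(x in `[a, +oo[) (normal_pdf 0 1 x)%:E
    <= (peak * expR (- a ^+ 2 / 2) / a)%:E)%E.
Proof.
move=> a0.
pose F (x : R) := - (peak / a) * expR (- x ^+ 2 / 2).
pose f (x : R) := peak / a * (x * expR (- x ^+ 2 / 2)).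
have pa0 : 0 < peak / a by rewrite divr_gt0// normal_peak1_gt0.
have dF (x : R) : is_derive x (1 : R) F (f x).
  rewrite /F /f; apply: is_derive_eq; rewrite /GRing.scale /=.
  by move: (expR _) (peak / a) => e q; lra.
have cf : continuous f.
  move=> x; apply: cvgM; first exact: cvg_cst.
  apply: cvgM; first exact: cvg_id.
  apply: (cvg_comp (fun x : R => - x ^+ 2 / 2) expR); last exact: continuous_expR.
  apply: cvgM; last exact: cvg_cst.
  by apply: cvgN; exact: exprn_continuous.
apply: (@le_trans _ _ (\int[leb]_(x in `[a, +oo[) (f x)%:E)%E).
  apply: ge0_le_integral => //.
  - by move=> x _; rewrite lee_fin normal_pdf_ge0.
  - exact: measurable_normal_pdf01.
  - by apply/measurable_EFinP; apply: measurable_funTS; exact: continuous_measurable_fun.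
  move=> x; rewrite /= in_itv/= andbT => ax; rewrite lee_fin normal_pdf01E /f.
  rewrite mulrA ler_wpM2r ?expR_ge0// mulrAC ler_pdivlMr// ler_wpM2l//.
  exact: normal_peak_ge0.
rewrite (@ge0_continuous_FTC2y _ f F a 0).
- by rewrite -EFinB lee_fin /F sub0r mulNr opprK mulrAC.
- move=> x ax; apply: mulr_ge0; first exact: ltW.
  by apply: mulr_ge0; [exact: le_trans (ltW a0) ax|exact: expR_ge0].
- exact: continuous_subspaceT.
- rewrite -[X in _ --> X](mulr0 (- (peak / a))); apply: cvgM; first exact: cvg_cst.
  apply: (@squeeze_cvgr _ _ _ _ (cst 0) (fun x : R => expR (- x))).
  (* For [x >= 2] one has [x^2 / 2 >= x], so [exp(-x)] dominates. *)
  + near=> x; rewrite /= expR_ge0 /= ler_expR mulNr lerN2.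
    have : 2 <= x by near: x; exact: nbhs_pinfty_ge.
    nra.
  + exact: cvg_cst.
  + exact: cvgr_expR.
- by move=> x _; case: (dF x).
- apply: cvg_at_right_filter; apply: differentiable_continuous.
  by apply/derivable1_diffP; case: (dF a).
by move=> x _; rewrite derive1E; case: (dF x).
Unshelve. all: by end_near.
Qed.

Local Open Scope ereal_scope.

Lemma integral_even_le (f : R -> \bar R) : measurable_fun setT f ->
  (forall x, 0 <= f x) -> (forall x, f (- x)%R = f x) ->
  \int[leb]_x f x <= 2%:E * \int[leb]_(x in `[0%R, +oo[) f x.
Proof.
move=> mf f0 feven.
have -> : [set: R] = `]-oo, 0%R]%classic `|` `]0%R, +oo[%classic.
  apply/seteqP; split=> x // _; rewrite /= !in_itv /= andbT.
  by case: (leP x 0%R); [left|right].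
rewrite ge0_integral_setU//=; last 2 first.
- exact: measurable_funTS.
- apply/disj_setPS => x [] /=; rewrite !in_itv /= andbT => h1 h2.
  by move: (le_lt_trans h1 h2); rewrite ltxx.
have -> : \int[leb]_(x in `]-oo, 0%R]) f x = \int[leb]_(x in `[0%R, +oo[) f x.
  rewrite (ge0_integration_by_substitution0 mf f0).
  by apply: eq_integral => x _; rewrite feven.
have -> : 2%:E = 1 + 1 :> \bar R by rewrite -EFinD.
rewrite ge0_muleDl// mul1e leeD2l//.
apply: ge0_subset_integral => //; first exact: measurable_funTS.
by move=> x /=; rewrite !in_itv/= !andbT; exact: ltW.
Qed.

End GaussianTail.

(** * Tail of a sum of squares: adding one square *)

Section ChiSquareStep.
Context {R : realType}.
Notation leb := (@lebesgue_measure R).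
Notation peak := (@normal_peak R 1).

(* Dominates P(S >= s), s > 0, for a sum S of n squares of independent standard
   normal variables.  For n >= 2 the factor max(1, sqrt s)^(n-2) makes the bound
   usable for small s too, where the plain power would be false. *)
Definition chi2_bound (n : nat) (s : R) : R :=
  match n with
  | 0 => 0
  | 1 => 2 * peak * expR (- s / 2) / Num.sqrt s
  | _ => 3 / 4 * n%:R ^+ 2 * Num.max 1 (Num.sqrt s) ^+ (n - 2) * expR (- s / 2)
  end.

Lemma within_continuous_inv_sqrt (a h : R) : h < a ->
  {within `[0, h], continuous (fun b : R => (Num.sqrt (a - b))^-1)}.
Proof.
move=> ha; apply: continuous_in_subspaceT => b; rewrite inE/= in_itv/= => /andP[b0 bh].
apply: cvgV; first by rewrite gt_eqF// sqrtr_gt0 subr_gt0 (le_lt_trans bh).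
apply: (cvg_comp (fun b : R => a - b) Num.sqrt); last exact: sqrt_continuous.
by apply: cvgB; [exact: cvg_cst|exact: cvg_id].
Qed.

(** Stopping at [h < a] keeps the integrand continuous, and the bound given by the antiderivative
    [- 2 sqrt(a - b)] does not depend on [h]. *)
Lemma integral_inv_sqrt_le (a h : R) : 0 < h -> h < a ->
  (\int[leb]_(b in `[0%R, h]) ((Num.sqrt (a - b))^-1%R)%:E <= (2 * Num.sqrt a)%:E)%E.
Proof.
move=> h0 ha.
pose F (b : R) : R := - 2 * Num.sqrt (a - b).
have dF (b : R) : b < a -> is_derive b (1 : R) F (Num.sqrt (a - b))^-1.
  move=> ba; have ab : 0 < a - b by rewrite subr_gt0.
  have ds : is_derive (a - b) (1 : R) Num.sqrt (2 * Num.sqrt (a - b))^-1.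
    exact: is_derive1_sqrt.
  pose g : R -> R := fun b => a - b.
  have dg : is_derive (b : R) (1 : R) g (-1 : R).
    have := is_deriveB (is_derive_cst a b (1 : R)) (is_derive_id b (1 : R)).
    by rewrite sub0r; exact.
  have dc : is_derive b (1 : R) (Num.sqrt \o g) ((2 * Num.sqrt (a - b))^-1 * -1).
    exact: is_derive1_comp.
  have dFb : is_derive b (1 : R) F (-2 * ((2 * Num.sqrt (a - b))^-1 * -1)).
    by have := is_deriveZ (-2 : R) dc; exact.
  apply: is_derive_eq.
  have sa : Num.sqrt (a - b) != 0 by rewrite gt_eqF// sqrtr_gt0.
  by field.
have cF (b : R) : b < a -> {for b, continuous F}.
  move=> ba; apply: differentiable_continuous; apply/derivable1_diffP.
  by case: (dF b ba).
rewrite (@continuous_FTC2 _ _ F 0 h)//.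
- rewrite /F subr0 -EFinB lee_fin.
  have := sqrtr_ge0 (a - h); lra.
- exact: within_continuous_inv_sqrt.
- split.
  + by move=> b; rewrite in_itv/= => /andP[b0 bh]; case: (dF b (lt_trans bh ha)).
  + by apply: cvg_at_right_filter; apply: cF; exact: lt_trans ha.
  + by apply: cvg_at_left_filter; exact: cF.
move=> b; rewrite in_itv/= => /andP[b0 bh]; rewrite derive1E.
by case: (dF b (lt_trans bh ha)).
Qed.

Local Open Scope ereal_scope.

Lemma measurable_sqr_tail (s : R) : measurable
  ([set z | s <= z.1 + z.2 ^+ 2]%R : set (measurableTypeR R * measurableTypeR R)).
Proof.
pose f (z : measurableTypeR R * measurableTypeR R) : measurableTypeR R := (z.1 + z.2 ^+ 2)%R.
have mf : measurable_fun setT f.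
  by apply: measurable_funD => //; apply: measurable_funX.
rewrite (_ : [set z | _] = f @^-1` `[s, +oo[%classic).
  by rewrite -[X in measurable X]setTI; apply: mf => //; exact: measurable_itv.
by apply/seteqP; split => z; rewrite /= in_itv/= andbT.
Qed.

Lemma product_normal_prob_sqr_le1 (m : probability (measurableTypeR R) R) (s : R) :
  (m \x normal_prob 0 1) [set z : R * R | (s <= z.1 + z.2 ^+ 2)%R] <= 1.
Proof. exact: (@probability_le1 _ _ _ (m \x normal_prob 0 1) _ (measurable_sqr_tail s)). Qed.

(** Conditioning on the normal coordinate [b]: the other one must be at least [s - b^2]. This is the
    opposite order of integration, equal to the first by uniqueness of the product measure.
    Measurability in [b] is recorded for the estimates that follow. *)
Lemma product_normal_prob_sqr (m : probability (measurableTypeR R) R) (s : R) :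
  measurable_fun setT (fun b : R => m `[(s - b ^+ 2)%R, +oo[%classic) /\
  (m \x normal_prob 0 1) [set z : R * R | (s <= z.1 + z.2 ^+ 2)%R] =
  \int[leb]_b (m `[(s - b ^+ 2)%R, +oo[%classic * (normal_pdf 0 1 b)%:E).
Proof.
set S := [set z | _]; have mS := measurable_sqr_tail s.
have secE b : ysection S b = `[(s - b ^+ 2)%R, +oo[%classic.
  by apply/seteqP; split => a; rewrite /ysection /= inE /S /= in_itv/= andbT lerBlDr.
have msec : measurable_fun setT (fun b : R => m `[(s - b ^+ 2)%R, +oo[%classic).
  have := @measurable_fun_ysection _ _ _ _ R m S mS.
  rewrite (_ : _ \o _ = fun b : R => m `[(s - b ^+ 2)%R, +oo[%classic)//.
  by apply/funext => b /=; rewrite secE.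
split=> //.
rewrite (@product_measure_unique _ _ _ _ R m (normal_prob 0 1)
  (m \x^ normal_prob 0 1) _ S mS) => [|A B mA mB]; last exact: product_measure2E.
rewrite /product_measure2 -integral_normal_prob//.
by apply: eq_integral => b _ /=; rewrite secE.
Qed.

(** Evenness in [b] gives the factor 2. For [b >= sqrt s] the tail of [m] is at most 1 and Mills'
    ratio applies; only [b < sqrt s], where [s - b^2 > 0], is left to the bound on [m]. *)
Lemma sqr_tail_split (m : probability (measurableTypeR R) R) (s : R) : (0 < s)%R ->
  (m \x normal_prob 0 1) [set z : R * R | (s <= z.1 + z.2 ^+ 2)%R] <=
  2%:E * \int[leb]_(b in `[0%R, Num.sqrt s[)
    (m `[(s - b ^+ 2)%R, +oo[%classic * (normal_pdf 0 1 b)%:E)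
  + (2 * peak * expR (- s / 2) / Num.sqrt s)%:E.
Proof.
move=> s0; have [mQ ->] := product_normal_prob_sqr m s.
set a := Num.sqrt s; have a0 : (0 < a)%R by rewrite sqrtr_gt0.
have a2 : (a ^+ 2 = s)%R by rewrite sqr_sqrtr// ltW.
set g := (fun b : R => _ * _).
have g0 b : 0 <= g b by rewrite mule_ge0// lee_fin normal_pdf_ge0.
have mg : measurable_fun setT g.
  by apply: emeasurable_funM => //; exact: measurable_normal_pdf01.
have geven b : g (- b)%R = g b by rewrite /g sqrrN !normal_pdf01E sqrrN.
apply: le_trans (integral_even_le mg g0 geven) _.
have -> : `[0%R, +oo[%classic = `[0%R, a[%classic `|` `[a, +oo[%classic :> set R.
  apply/seteqP; split=> x; rewrite /= !in_itv /= !andbT.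
    by move=> x0; rewrite x0 /=; case: (ltP x a); [left|right].
  by case=> [/andP[]//|]; exact: le_trans (ltW a0).
rewrite ge0_integral_setU//=; last 2 first.
- exact: measurable_funTS.
- apply/disj_setPS => x [] /=; rewrite !in_itv /= andbT => /andP[_ h1] h2.
  by move: (le_lt_trans h2 h1); rewrite ltxx.
rewrite ge0_muleDr ?integral_ge0//; apply: leeD2l.
have -> : (2 * peak * expR (- s / 2) / a = 2 * (peak * expR (- a ^+ 2 / 2) / a))%R.
  by rewrite a2 !mulrA.
rewrite EFinM; apply: lee_wpmul2l => //; apply: le_trans (mills_ratio a0).
apply: ge0_le_integral => //.
- exact: measurable_funTS.
- exact: measurable_normal_pdf01.
move=> b _; rewrite /g -[leRHS]mul1e; apply: lee_wpmul2r; first by rewrite lee_fin normal_pdf_ge0.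
exact: probability_le1.
Qed.

Lemma expR_half_ge (s : R) : (0 < s <= 1 -> 1 / 2 <= expR (- s / 2))%R.
Proof. by move=> /andP[s0 s1]; have := expR_ge1Dx (- s / 2)%R; lra. Qed.

Lemma integral_le_cst (f : R -> \bar R) (x y c : R) : (x <= y)%R -> (0 <= c)%R ->
  measurable_fun setT f -> (forall b, 0 <= f b) ->
  (forall b, (x <= b < y)%R -> f b <= c%:E) ->
  \int[leb]_(b in `[x, y[) f b <= (c * (y - x))%:E.
Proof.
move=> xy c0 mf f0 fc.
apply: (@le_trans _ _ (\int[leb]_(b in `[x, y[) c%:E)).
  by apply: ge0_le_integral => //; exact: measurable_funTS.
rewrite integral_cst//= lebesgue_measure_itv/= lte_fin; case: ltP => [_|yx].
  by rewrite -EFinB -EFinM.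
have -> : y = x by apply/eqP; rewrite eq_le xy yx.
by rewrite subrr mule0 mulr0.
Qed.

(** The exponentials in [s - b^2] and [b^2] multiply to [exp(-s / 2)] for every [b], so the
    integrand has a constant bound on [[0, sqrt s[] and the length of that interval supplies the new
    power of [sqrt s]. *)
Lemma chi2_bound_step_ge2 n (m : probability (measurableTypeR R) R) : (1 < n)%N ->
  (forall s, (0 < s)%R -> m `[s, +oo[%classic <= (chi2_bound n s)%:E) ->
  forall s, (0 < s)%R ->
    (m \x normal_prob 0 1) [set z : R * R | (s <= z.1 + z.2 ^+ 2)%R]
      <= (chi2_bound n.+1 s)%:E.
Proof.
case: n => [|[|n]]// _ mtail s s0.
have peak0 : (0 < peak)%R := normal_peak1_gt0.
have peak1 : (peak < 2 / 5)%R := normal_peak1_lt.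
have e0 := expR_gt0 (- s / 2)%R.
set N : R := n.+2%:R; have N2 : (2 <= N)%R by rewrite ler_nat.
have N1 : n.+3%:R = (N + 1)%R by rewrite natr1.
(* For [s <= 1] the claimed bound exceeds 1, since [3/4 * 9 * 1/2 > 1]; beyond 1 the maximum is
   [sqrt s]. *)
have [s1|s1] := leP s 1%R.
  apply: le_trans (product_normal_prob_sqr_le1 m s) _.
  rewrite lee_fin /chi2_bound (max_idPl _); last by rewrite -[leRHS]sqrtr1 ler_wsqrtr.
  rewrite expr1n mulr1 N1.
  have := expR_half_ge (s := s); rewrite s0 s1 => /(_ isT); nra.
have [mQ _] := product_normal_prob_sqr m s.
apply: le_trans (sqr_tail_split m s0) _.
set a := Num.sqrt s; have a1 : (1 <= a)%R by rewrite -[leLHS]sqrtr1 ler_wsqrtr// ltW.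
have a2 : (a ^+ 2 = s)%R by rewrite sqr_sqrtr// ltW.
set c := (peak * (3 / 4 * N ^+ 2 * a ^+ n * expR (- s / 2)))%R.
have an : (1 <= a ^+ n)%R by rewrite exprn_ege1.
have c0 : (0 <= c)%R by rewrite !mulr_ge0 ?sqr_ge0 ?ltW// (lt_le_trans ltr01).
apply: (@le_trans _ _ (2%:E * (c * (a - 0))%:E + (2 * peak * expR (- s / 2) / a)%:E)).
  rewrite leeD2r// lee_wpmul2l//; apply: integral_le_cst => //.
  - by rewrite (le_trans _ a1).
  - by apply: emeasurable_funM => //; exact: measurable_normal_pdf01.
  - by move=> b; rewrite mule_ge0// lee_fin normal_pdf_ge0.
  move=> b /andP[b0 ba].
  have sb : (0 < s - b ^+ 2)%R by rewrite subr_gt0 -a2 ltr_sqr// nnegrE (le_trans _ a1).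
  apply: (@le_trans _ _ ((chi2_bound n.+2 (s - b ^+ 2))%:E * (normal_pdf 0 1 b)%:E)).
    by rewrite lee_wpmul2r// ?mtail// lee_fin normal_pdf_ge0.
  rewrite -EFinM lee_fin normal_pdf01E /chi2_bound /c -/N !subSS subn0.
  have -> : (expR (- s / 2) = expR (- (s - b ^+ 2) / 2) * expR (- b ^+ 2 / 2))%R.
    by rewrite -expRD; congr expR; lra.
  rewrite mulrCA !mulrA -[leRHS]mulrA -[leLHS]mulrA.
  rewrite ler_wpM2r ?mulr_ge0 ?expR_ge0// ler_wpM2l//.
    by rewrite !mulr_ge0 ?sqr_ge0// ltW.
  apply: lerXn2r; rewrite ?nnegrE.
  - by rewrite le_max ler01.
  - exact: le_trans a1.
  by rewrite ge_max a1 ler_wsqrtr// gerBl sqr_ge0.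
rewrite -!EFinM -EFinD lee_fin /chi2_bound N1 !subSS subn0 (max_idPr a1) -/a subr0.
rewrite /c; move: (expR _) e0 => e e0; rewrite (exprS a n).
have e2 : (2 * peak * e / a <= e)%R.
  by rewrite ler_pdivrMr ?(lt_le_trans ltr01)//; nra.
move: (a ^+ n)%R an => p an.
have ap : (1 <= a * p)%R by rewrite mulr_ege1.
have -> : (2 * (peak * (3 / 4 * N ^+ 2 * p * e) * a) = 2 * peak * (3 / 4 * N ^+ 2) * (a * p) * e)%R.
  by ring.
move: (a * p)%R ap => q q1.
(* Here [2 peak < 1] absorbs the peak, and passing from [N^2] to [(N + 1)^2] gains [3/2 N + 3/4],
   which pays for the Mills term, at most [q e]. *)
apply: (@le_trans _ _ ((3 / 4 * N ^+ 2 * q + q) * e)%R); last first.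
  rewrite ler_wpM2r ?(ltW e0)// -subr_ge0.
  rewrite [leRHS](_ : _ = (3 / 2 * N - 1 / 4) * q)%R; last by field.
  by rewrite mulr_ge0//; lra.
rewrite [leRHS]mulrDl; apply: lerD; last by apply: le_trans e2 _; rewrite ler_peMl// ltW.
rewrite ler_wpM2r ?(ltW e0)// ler_wpM2r ?(le_trans _ q1)// ler_piMl//; last by lra.
by rewrite mulr_ge0 ?sqr_ge0.
Qed.

(** The bound 0 says that [m] has no mass on the positive reals, so only the Mills term survives. *)
Lemma chi2_bound_step0 (m : probability (measurableTypeR R) R) :
  (forall s, (0 < s)%R -> m `[s, +oo[%classic <= (chi2_bound 0 s)%:E) ->
  forall s, (0 < s)%R ->
    (m \x normal_prob 0 1) [set z : R * R | (s <= z.1 + z.2 ^+ 2)%R]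
      <= (chi2_bound 1 s)%:E.
Proof.
move=> mtail s s0; have [mQ _] := product_normal_prob_sqr m s.
apply: le_trans (sqr_tail_split m s0) _.
rewrite -[leRHS]add0e leeD2r// -(mule0 2%:E) lee_wpmul2l//.
rewrite -[leRHS](_ : (0 * (Num.sqrt s - 0))%:E = 0); last by rewrite mul0r.
apply: integral_le_cst => //.
- by apply: emeasurable_funM => //; exact: measurable_normal_pdf01.
- by move=> b; rewrite mule_ge0// lee_fin normal_pdf_ge0.
move=> b /andP[b0 ba].
have sb : (0 < s - b ^+ 2)%R.
  by rewrite subr_gt0 -(sqr_sqrtr (ltW s0)) ltr_sqr// nnegrE.
by have := mtail _ sb; rewrite /chi2_bound measure_le0 => /eqP ->; rewrite mul0e.
Qed.

(** Separate from the general step because [chi2_bound 1] at [s - b^2] blows up as [b] tends to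
    [sqrt s], so that no constant dominates it. *)
Lemma chi2_bound_step1 (m : probability (measurableTypeR R) R) :
  (forall s, (0 < s)%R -> m `[s, +oo[%classic <= (chi2_bound 1 s)%:E) ->
  forall s, (0 < s)%R ->
    (m \x normal_prob 0 1) [set z : R * R | (s <= z.1 + z.2 ^+ 2)%R]
      <= (chi2_bound 2 s)%:E.
Proof.
move=> mtail s s0.
have peak0 : (0 < peak)%R := normal_peak1_gt0.
have peak1 : (peak < 2 / 5)%R := normal_peak1_lt.
have e0 := expR_gt0 (- s / 2)%R.
have bound2 : chi2_bound 2 s = (3 * expR (- s / 2))%R.
  by rewrite /chi2_bound subnn expr0 mulr1; congr (_ * _)%R; field.
have [s1|s1] := leP s 1%R.
  apply: le_trans (product_normal_prob_sqr_le1 m s) _.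
  rewrite lee_fin bound2; have := expR_half_ge (s := s); rewrite s0 s1 => /(_ isT).
  lra.
have [mQ _] := product_normal_prob_sqr m s.
apply: le_trans (sqr_tail_split m s0) _; rewrite bound2.
set a := Num.sqrt s; have a1 : (1 <= a)%R by rewrite -[leLHS]sqrtr1 ler_wsqrtr// ltW.
have a0 : (0 < a)%R by exact: lt_le_trans a1.
have a2 : (a ^+ 2 = s)%R by rewrite sqr_sqrtr// ltW.
set g := (fun b : R => _ * _).
have g0 b : 0 <= g b by rewrite mule_ge0// lee_fin normal_pdf_ge0.
have mg : measurable_fun setT g.
  by apply: emeasurable_funM => //; exact: measurable_normal_pdf01.
(* The bound on the tail of m is singular at b = a: it is used up to a - 1 / (4 a),
   with a^2 - b^2 >= a (a - b), and replaced by 1 on the remaining short interval. *)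
pose dl := (1 / (4 * a))%R; pose h := (a - dl)%R.
have adl : (a * dl = 1 / 4)%R by rewrite /dl; field; rewrite gt_eqF.
have dl0 : (0 < dl)%R by rewrite divr_gt0// mulr_gt0.
have dl1 : (dl <= 1 / 4)%R by nra.
have ha : (h < a)%R by rewrite /h ltrBlDr ltrDl.
have h0 : (0 < h)%R by rewrite /h; lra.
have -> : `[0%R, a[%classic = `[0%R, h]%classic `|` `]h, a[%classic :> set R.
  apply/seteqP; split=> x; rewrite /= !in_itv /=.
    by move=> /andP[x0 xa]; rewrite x0 xa andbT /=; case: (leP x h); [left|right].
  case=> [/andP[x0 xh]|/andP[hx xa]]; first by rewrite x0 (le_lt_trans xh).
  by rewrite xa andbT ltW// (lt_trans h0).
rewrite ge0_integral_setU//=; last 3 first.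
- exact: (measurable_funTS mg).
- by move=> x _; exact: g0.
- apply/disj_setPS => x [] /=; rewrite !in_itv /= => /andP[_ h1] /andP[h2 _].
  by move: (le_lt_trans h1 h2); rewrite ltxx.
set e := expR (- s / 2).
have eE b : (e = expR (- (s - b ^+ 2) / 2) * expR (- b ^+ 2 / 2))%R.
  by rewrite -expRD; congr expR; lra.
(* The factor [1 / sqrt a] left by [s - b^2 >= a (a - b)] cancels against the [sqrt a] of
   [integral_inv_sqrt_le]. *)
have part1 : \int[leb]_(b in `[0%R, h]) g b <= (4 * peak ^+ 2 * e)%:E.
  pose c := (2 * peak ^+ 2 * e / Num.sqrt a)%R.
  have sa : (0 < Num.sqrt a)%R by rewrite sqrtr_gt0.
  have c0 : (0 <= c)%R.
    by rewrite /c divr_ge0 ?(ltW sa)// mulr_ge0 ?(ltW e0)// mulr_ge0 ?sqr_ge0.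
  have mf : measurable_fun `[0%R, h] (fun b : R => ((Num.sqrt (a - b))^-1%R)%:E).
    apply/measurable_EFinP; apply: subspace_continuous_measurable_fun => //.
    exact: within_continuous_inv_sqrt.
  apply: (@le_trans _ _ (\int[leb]_(b in `[0%R, h]) (c%:E * ((Num.sqrt (a - b))^-1%R)%:E))).
    apply: ge0_le_integral => //.
    - exact: measurable_funTS.
    - exact: emeasurable_funM.
    move=> b; rewrite /= in_itv/= => /andP[b0 bh].
    have ba : (b < a)%R by exact: le_lt_trans ha.
    have sb : (s - b ^+ 2 = (a + b) * (a - b))%R by rewrite -a2; ring.
    have sb0 : (0 < s - b ^+ 2)%R by rewrite sb mulr_gt0 ?subr_gt0// ltr_wpDr.
    apply: (@le_trans _ _ ((chi2_bound 1 (s - b ^+ 2))%:E * (normal_pdf 0 1 b)%:E)).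
      by rewrite lee_wpmul2r// ?mtail// lee_fin normal_pdf_ge0.
    rewrite -!EFinM lee_fin normal_pdf01E /chi2_bound /c (eE b).
    have -> : (2 * peak * expR (- (s - b ^+ 2) / 2) / Num.sqrt (s - b ^+ 2) *
        (peak * expR (- b ^+ 2 / 2)) = 2 * peak ^+ 2 *
        (expR (- (s - b ^+ 2) / 2) * expR (- b ^+ 2 / 2)) / Num.sqrt (s - b ^+ 2))%R by ring.
    rewrite -[leRHS]mulrA ler_wpM2l//.
      by do 2?apply: mulr_ge0; rewrite ?sqr_ge0 ?expR_ge0// mulr_ge0 ?expR_ge0.
    rewrite -invfM -sqrtrM ?(ltW a0)// lef_pV2 ?posrE ?sqrtr_gt0 ?mulr_gt0 ?subr_gt0//; last by rewrite -subr_gt0.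
    by rewrite ler_wsqrtr// sb ler_wpM2r ?subr_ge0 ?(ltW ba)// lerDl.
  rewrite ge0_integralZl_EFin//.
  apply: (@le_trans _ _ (c%:E * (2 * Num.sqrt a)%:E)).
    by rewrite lee_wpmul2l// ?lee_fin//; exact: integral_inv_sqrt_le.
  rewrite -EFinM lee_fin /c le_eqVlt; apply/orP; left; apply/eqP.
  by field; rewrite gt_eqF.
(* Here [s - b^2 <= 2 a dl = 1/2], so [exp(-(s - b^2) / 2) >= 3/4] and the density is at most
   [4/3 peak e], on a length [dl <= 1/4]. *)
have part2 : \int[leb]_(b in `]h, a[) g b <= (peak * e / 3)%:E.
  apply: (@le_trans _ _ (\int[leb]_(b in `[h, a[) g b)).
    apply: ge0_subset_integral => //; first exact: measurable_funTS.
    by move=> b /=; rewrite !in_itv/= => /andP[/ltW -> ->].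
  apply: (@le_trans _ _ ((peak * e * (4 / 3)) * (a - h))%:E).
    apply: integral_le_cst => //; first exact: ltW.
      by rewrite !mulr_ge0// ltW.
    move=> b /andP[hb ba]; apply: (@le_trans _ _ (1 * (normal_pdf 0 1 b)%:E)).
      rewrite lee_wpmul2r ?lee_fin ?normal_pdf_ge0//.
      by apply: probability_le1; exact: measurable_itv.
    rewrite mul1e lee_fin normal_pdf01E -mulrA ler_wpM2l ?(ltW peak0)// (eE b).
    rewrite mulrAC ler_peMl ?expR_ge0//.
    have -> : (- (s - b ^+ 2) / 2 = - ((s - b ^+ 2) / 2))%R by lra.
    have : (s - b ^+ 2 <= 1 / 2)%R by rewrite -a2; rewrite /h in hb; nra.
    have := expR_ge1Dx (- ((s - b ^+ 2) / 2))%R; lra.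
  by rewrite lee_fin /h; have := mulr_gt0 peak0 e0; rewrite -/e; nra.
rewrite -/e.
apply: (@le_trans _ _ (2%:E * ((4 * peak ^+ 2 * e)%:E + (peak * e / 3)%:E)
  + (2 * peak * e / a)%:E)).
  by rewrite leeD2r// lee_wpmul2l// leeD.
rewrite [leLHS](_ : _ = (2 * (4 * peak ^+ 2 * e + peak * e / 3) + 2 * peak * e / a)%:E)// lee_fin.
(* With [peak < 2/5] the total is at most [(32/25 + 4/15 + 4/5) e], which is below [3 e]. *)
have : (2 * peak * e / a <= 2 * peak * e)%R.
  rewrite ler_pdivrMr// ler_peMr//; by rewrite !mulr_ge0// ltW.
have : (peak ^+ 2 <= 4 / 25)%R by nra.
rewrite -/e in e0; nra.
Qed.

Lemma chi2_bound_step n (m : probability (measurableTypeR R) R) :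
  (forall s, (0 < s)%R -> m `[s, +oo[%classic <= (chi2_bound n s)%:E) ->
  forall s, (0 < s)%R ->
    (m \x normal_prob 0 1) [set z : R * R | (s <= z.1 + z.2 ^+ 2)%R]
      <= (chi2_bound n.+1 s)%:E.
Proof.
case: n => [|[|n]]; [exact: chi2_bound_step0|exact: chi2_bound_step1|].
exact: chi2_bound_step_ge2.
Qed.

End ChiSquareStep.

(** * The noise in one block *)

Section Standardize.
Context {R : realType}.
Notation leb := (@lebesgue_measure R).
Local Open Scope ereal_scope.

(** Same uniqueness argument as for translations, applied to the image measure rescaled by
    [c^-1]. *)
Lemma integral_scale (c : R) (f : R -> \bar R) : (0 < c)%R ->
  measurable_fun setT f -> (forall x, 0 <= f x) ->
  \int[leb]_x f (x / c)%R = c%:E * \int[leb]_x f x.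
Proof.
move=> c0 mf f0.
pose phi (x : measurableTypeR R) : measurableTypeR R := (x / c)%R.
have mphi : measurable_fun setT phi by exact: measurable_funM.
transitivity (\int[pushforward leb phi]_x f x).
  by rewrite (ge0_integral_pushforward mphi)// => x _; exact: f0.
have k0 : (0 <= c^-1)%R by rewrite invr_ge0 ltW.
have kc0 : (0 <= c)%R by rewrite ltW.
transitivity (\int[mscale (NngNum kc0) leb]_x f x); last by rewrite ge0_integral_mscale.
apply: eq_measure_integral => //= A mA _.
have -> : pushforward leb phi A = c%:E * (c^-1%:E * pushforward leb phi A).
  by rewrite muleA -EFinM divff ?gt_eqF// mul1e.
rewrite /mscale /=; congr (_ * _).
rewrite (lebesgue_measure_unique (mu := mscale (NngNum k0) (pushforward leb phi)) _ mA)//.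
move=> _ [[x y] _ <-].
have pre : phi @^-1` `]x, y]%classic = `](x * c)%R, (y * c)%R]%classic.
  by apply/seteqP; split => z /=; rewrite /phi !in_itv /= ltr_pdivlMr// ler_pdivrMr.
transitivity (c^-1%:E * leb `](x * c)%R, (y * c)%R]%classic); last by rewrite -pre.
rewrite !lebesgue_measure_itv/= !lte_fin ltr_pM2r//; case: ifP => _; last by rewrite mule0.
by rewrite -!EFinB -EFinM -mulrBl; congr (_%:E); field; rewrite gt_eqF.
Qed.

Lemma normal_pdf_scale (c x : R) : (0 < c)%R ->
  normal_pdf 0 c x = (c^-1 * normal_pdf 0 1 (x / c))%R.
Proof.
move=> c0; rewrite !normal_pdfE ?oner_neq0 ?gt_eqF//= mulrA; congr (_ * _)%R.
  rewrite /normal_peak expr1n mul1r -mulrnAr sqrtrM ?sqr_ge0// sqrtr_sqr gtr0_norm//.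
  by rewrite invfM.
rewrite /normal_fun !subr0 expr1n; congr expR.
by field; rewrite gt_eqF.
Qed.

Lemma normal_prob_scale (c : R) (A : set R) : (0 < c)%R -> measurable A ->
  normal_prob 0 c [set x | A (x / c)%R] = normal_prob 0 1 A.
Proof.
move=> c0 mA.
pose f := (fun y : R => (normal_pdf 0 1 y)%:E) \_ A.
have mf : measurable_fun setT f.
  apply: (iffLR (measurable_restrictT (fun y : R => (normal_pdf 0 1 y)%:E) mA)).
  exact: measurable_normal_pdf01.
have f0 y : 0 <= f y.
  by rewrite /f patchE; case: ifP => // _; rewrite lee_fin normal_pdf_ge0.
have mfc : measurable_fun setT (fun x : R => f (x / c)%R).
  by apply: measurableT_comp => //; exact: measurable_funM.
rewrite /normal_prob [RHS]integral_mkcond -/f.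
have -> : \int[leb]_y f y = c^-1%:E * \int[leb]_x f (x / c)%R.
  by rewrite integral_scale// muleA -EFinM mulVf ?gt_eqF// mul1e.
have kc0 : (0 <= c^-1)%R by rewrite invr_ge0 ltW.
rewrite -(ge0_integralZl_EFin leb measurableT (fun y _ => f0 (y / c)%R) mfc kc0).
rewrite [LHS]integral_mkcond; apply: eq_integral => x _; rewrite /f !patchE.
have -> : (x \in [set x | A (x / c)%R]) = ((x / c)%R \in A).
  by apply/idP/idP; rewrite !inE.
by case: ifP => _; rewrite ?mule0// normal_pdf_scale// EFinM.
Qed.

Lemma iid_normal_standardize dT (T : measurableType dT) (P : probability T R) L
  (w : 'I_L -> {RV P >-> R}) (c : R) : (0 < c)%R -> mutually_independent w ->
  (forall (i : 'I_L) (A : set R), measurable A -> P (w i @^-1` A) = normal_prob 0 c A) ->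
  iid_normal P (fun i t => w i t / c)%R.
Proof.
move=> c0 indep law.
have mdiv : measurable_fun setT (fun x : R => x / c)%R by exact: measurable_funM.
split=> [r|B mB]; first exact: (measurableT_comp mdiv (measurable_funP (w r))).
have mB' r : measurable [set x : R | B r (x / c)%R].
  by rewrite -[X in measurable X]setTI; apply: mdiv.
have := indep (fun r => [set x | B r (x / c)%R]) mB' => /= ->.
by apply: eq_bigr => r _; rewrite law// normal_prob_scale.
Qed.

End Standardize.

(** * Comparison of the tail bound for n squares with its form at d *)

Section BoundComparison.
Context {R : realType}.

(** As [sqrt t >= 1], powers and prefactors may be raised from [n] to [d]. Strictness comes from
    [2 peak < 4/5] when [n = 1] and from [3/4 < 4/5] when [n >= 2]. *)
Lemma chi2_bound_lt (n d : nat) (t : R) : (n <= d)%N -> (0 < d)%N -> 1 <= t ->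
  chi2_bound n t < 4 / 5 * d%:R ^+ 2 * t `^ (d%:R / 2 - 1) * expR (- t / 2).
Proof.
move=> nd d0 t1; have t0 : 0 < t by exact: lt_le_trans t1.
have e0 := expR_gt0 (- t / 2).
set a := Num.sqrt t; have a1 : 1 <= a by rewrite -[leLHS]sqrtr1 ler_wsqrtr.
have a0 : 0 < a by exact: lt_le_trans a1.
have a2 : a ^+ 2 = t by rewrite sqr_sqrtr// ltW.
have pw : t `^ (d%:R / 2 - 1) = a ^+ d / t.
  have -> : a ^+ d = t `^ (d%:R / 2).
    by rewrite (mulrC d%:R) powRrM powR12_sqrt ?(ltW t0)// powR_mulrn ?sqrtr_ge0.
  by rewrite powRD ?(gt_eqF t0) ?implybT// powRN powRr1 ?(ltW t0).
have d1 : 1 <= d%:R :> R by rewrite ler1n.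
rewrite pw.
case: n nd => [|[|n]] nd.
- by rewrite /chi2_bound !mulr_gt0 ?exprn_gt0 ?invr_gt0 ?(lt_le_trans ltr01 d1).
- rewrite /chi2_bound -/a mulrAC ltr_pM2r// ltr_pdivrMr//.
  have ad : 1 <= a ^+ d / t * a.
    by rewrite -a2 mulrAC ler_pdivlMr ?exprn_gt0// mul1r -exprSr ler_weXn2l.
  have := @normal_peak1_lt R; have d2 : 1 <= d%:R ^+ 2 :> R by rewrite exprn_ege1.
  have : 1 <= d%:R ^+ 2 * (a ^+ d / t * a) by rewrite mulr_ege1.
  lra.
rewrite /chi2_bound ltr_pM2r// (max_idPr a1) -/a -a2.
have d2 : (2 <= d)%N by exact: leq_trans nd.
have -> : a ^+ d / a ^+ 2 = a ^+ (d - 2).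
  by rewrite -{1}(subnK d2) exprD mulfK// expf_neq0// gt_eqF.
have nd2 : n.+2%:R ^+ 2 <= d%:R ^+ 2 :> R by rewrite lerXn2r ?nnegrE ?ler_nat.
have an : a ^+ (n.+2 - 2) <= a ^+ (d - 2) by rewrite ler_weXn2l// leq_sub2r.
have ap : 0 < a ^+ (d - 2) by rewrite exprn_gt0.
apply: (@le_lt_trans _ _ (3 / 4 * d%:R ^+ 2 * a ^+ (d - 2))).
  apply: ler_pM; [|by rewrite exprn_ge0// ltW|by rewrite ler_wpM2l|by []].
  by rewrite mulr_ge0// sqr_ge0.
rewrite ltr_pM2r// ltr_pM2r ?exprn_gt0 ?(lt_le_trans ltr01 d1)//; lra.
Qed.

End BoundComparison.

(** * Tail of the noise seen by one block *)

Section BlockNoise.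
Context {R : realType} {dT : measure_display} {T : measurableType dT}.
Variables (P : probability T R) (L M d : nat) (D : 'M[R]_(L, M * d)).
Hypothesis unitD : forall c, vnorm (col c D) = 1.
Let lam := 1 + (d%:R - 1) * sub_coherence D.

(** Gershgorin controls [B] through its Gram matrix, but the noise is [v = B^T uK]. Duality
    transfers the bound: [|v|^2 = uK . B v <= |uK| |B v|] and [|B v|^2 <= lam |v|^2]. *)
Lemma reduced_noise_le (u : 'I_L -> R) (A : 'I_L -> 'I_d -> R) (K : {set 'I_L}) l :
  0 <= lam -> (forall j j', \sum_r A r j * A r j' = \sum_r D r (bidx l j) * D r (bidx l j')) ->
  (forall r j, r \notin K -> A r j = 0) ->
  \sum_j (\sum_r A r j * u r) ^+ 2 <= lam * \sum_(r in K) u r ^+ 2.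
Proof.
move=> lam0 gram supp.
pose v : 'cV[R]_d := \col_j \sum_r A r j * u r.
pose B : 'M[R]_(L, d) := \matrix_(r, j) A r j.
pose uK : 'cV[R]_L := \col_r (if r \in K then u r else 0).
have -> : \sum_j (\sum_r A r j * u r) ^+ 2 = vnorm v ^+ 2.
  by rewrite sqr_vnorm; apply: eq_bigr => j _; rewrite !mxE expr2.
have -> : \sum_(r in K) u r ^+ 2 = vnorm uK ^+ 2.
  rewrite sqr_vnorm big_mkcond; apply: eq_bigr => r _; rewrite !mxE.
  by case: ifP => _; rewrite ?mul0r ?expr2.
have vE : v = B^T *m uK.
  apply/colP => j; rewrite !mxE; apply: eq_bigr => r _; rewrite !mxE.
  by case: ifPn => // rK; rewrite supp// !mul0r.
have BD : vnorm (B *m v) ^+ 2 = vnorm (Dblk D l *m v) ^+ 2.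
  rewrite !sqr_vnorm -!dot_mulmx !mulmxA; congr (dot (_ *m v) v).
  by apply/matrixP => j j'; rewrite !mxE; under eq_bigr do rewrite !mxE;
    rewrite gram; apply: eq_bigr => r _; rewrite !mxE.
have Bv : vnorm (B *m v) ^+ 2 <= lam * vnorm v ^+ 2.
  rewrite BD; have := block_gram l v unitD; rewrite ler_norml => /andP[_].
  rewrite /lam; lra.
have [v0|v0] := eqVneq (vnorm v) 0.
  by rewrite v0 expr0n mulr_ge0// sqr_ge0.
have vp : 0 < vnorm v ^+ 2 by rewrite exprn_gt0// lt_def v0 vnorm_ge0.
have cs : vnorm v ^+ 2 <= vnorm uK * vnorm (B *m v).
  by rewrite sqr_vnorm {1}vE dot_mulmx cauchy_schwarz.
rewrite -(ler_pM2r vp) -expr2.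
apply: (@le_trans _ _ ((vnorm uK * vnorm (B *m v)) ^+ 2)).
  by rewrite ler_sqr// nnegrE ?(ltW vp) ?mulr_ge0 ?vnorm_ge0.
by rewrite exprMn -[leRHS]mulrA [leRHS]mulrCA ler_wpM2l// sqr_ge0.
Qed.

Lemma block_noise_measurable (w : 'I_L -> {RV P >-> R}) l :
  measurable_fun setT (fun t => vnorm ((Dblk D l)^T *m (\col_(r < L) w r t)) ^+ 2).
Proof.
under eq_fun do rewrite sqr_vnorm /dot.
apply: measurable_sum => j; under eq_fun do rewrite -expr2 mxE.
apply: measurable_funX; apply: measurable_sum => r.
under eq_fun do rewrite !mxE.
by apply: measurable_funM => //; exact: (measurable_funP (w r)).
Qed.

(** After cancelling [sigma^2] and [lam], the event forces the squares of the rotated coordinates in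
    [K] to sum to at least [t]; the witness [n] is [#|K|]. *)
Lemma block_noise_tail (w : 'I_L -> {RV P >-> R}) (sigma t : R) l :
  0 < sigma -> 0 < lam -> 0 < t -> iid_normal P (fun i x => w i x / sigma) ->
  exists2 n, (n <= d)%N &
    (P [set x | (sigma ^+ 2 * (t * lam)
        <= vnorm ((Dblk D l)^T *m (\col_(r < L) w r x)) ^+ 2)%R]
      <= (chi2_bound n t)%:E)%E.
Proof.
move=> sigma0 lam0 t0 iidu.
have [u [A [K [iid' [same gram] Kd supp]]]] :=
  triangularize (fun r j => D r (bidx l j)) iidu.
exists #|K| => //.
have G0 s : 0 < s -> 0 <= chi2_bound 0 s :> R by [].
apply: le_trans (sumsq_tail iid' G0 (@chi2_bound_step R) K t0).
apply: le_measure; rewrite ?inE.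
- rewrite -[X in measurable X]setTI.
  have := block_noise_measurable w l measurableT (measurable_itv `[sigma ^+ 2 * (t * lam), +oo[).
  congr (measurable (_ `&` _)); apply/seteqP; split => x; by rewrite /= in_itv/= andbT.
- rewrite -[X in measurable X]setTI.
  have := measurable_sumsq iid' K measurableT (measurable_itv `[t, +oo[).
  congr (measurable (_ `&` _)); apply/seteqP; split => x; by rewrite /= in_itv/= andbT.
move=> x /= h.
have s2 : 0 < sigma ^+ 2 by rewrite exprn_gt0.
have e : vnorm ((Dblk D l)^T *m (\col_(r < L) w r x)) ^+ 2 =
    sigma ^+ 2 * \sum_j (\sum_r A r j * u r x) ^+ 2.
  rewrite sqr_vnorm mulr_sumr; apply: eq_bigr => j _; rewrite -expr2 -exprMn.
  congr (_ ^+ 2); rewrite same mulr_sumr mxE; apply: eq_bigr => r _.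
  by rewrite !mxE; field; rewrite gt_eqF.
move: h; rewrite e ler_pM2l// => h.
by rewrite -(ler_pM2r lam0) (le_trans h)// mulrC (reduced_noise_le _ (ltW lam0) gram supp).
Qed.

End BlockNoise.

(** * Union bound and conclusion *)

Lemma measure_union_le {R : realType} {dT} {T : measurableType dT} (P : probability T R)
  (I : finType) (F : I -> set T) : (forall i, measurable (F i)) ->
  (P [set t | exists i, F i t] <= \sum_i P (F i))%E.
Proof.
move=> mF.
have -> : [set t | exists i, F i t] = \big[setU/set0]_i F i.
  apply/seteqP; split => t /=.
    by move=> [i Fit]; rewrite (bigD1 i)//=; left.
  by elim/big_rec: _ => // i A _ IH [Fit|/IH//]; exists i.
suff : (measurable (\big[setU/set0]_i F i) /\
    P (\big[setU/set0]_i F i) <= \sum_i P (F i))%E by case.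
elim/big_rec2: _ => [|i x A _ [mA Ax]]; first by rewrite measure0.
split; first exact: measurableU.
by apply: le_trans (measureU2 _ _ _) _ => //; exact: leeD.
Qed.

Unset Implicit Arguments.

Theorem theorem5
  (R : realType) (M d L k : nat)
  (D : 'M[R]_(L, M * d)) (x : 'cV[R]_(M * d))
  (dT : measure_display) (T : measurableType dT) (P : probability T R)
  (w : 'I_L -> {RV P >-> R}) (sigma alpha : R) :
  (0 < d)%N ->
  (L < M * d)%N ->
  (forall c : 'I_(M * d), vnorm (col c D) = 1) ->
  (forall I : {set 'I_M}, (#|I| <= k)%N ->
     forall v : 'cV[R]_(M * d), bsupp v \subset I -> D *m v = 0 -> v = 0) ->
  (#|bsupp x| <= k)%N ->
  x != 0 ->
  0 < sigma ->
  mutually_independent w ->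
  (forall (i : 'I_L) (A : set R), measurable A ->
     P (w i @^-1` A) = normal_prob 0 sigma A) ->
  1 / (2 * d%:R * ln (M * d)%:R) <= alpha ->
  (1 - (d%:R - 1) * sub_coherence D) * xmin x
    - (2 * k%:R - 1) * d%:R * block_coherence D * xmin x
    >= 2 * sigma * Num.sqrt (2 * alpha * d%:R * (1 + (d%:R - 1) * sub_coherence D)
                             * ln (M * d)%:R) ->
  exists A : set T, measurable A /\
    (A `<=` [set t | forall (idx : nat -> 'I_M) (xs : nat -> 'cV[R]_(M * d)),
        bomp_run D (D *m x + \col_(r < L) w r t) k idx xs ->
        bsupp x \subset selected idx k /\
        vnorm (xs k - x) ^+ 2 <=
          2 * alpha * (1 + (d%:R - 1) * sub_coherence D)
          / (1 - (d%:R - 1) * sub_coherence D - (k%:R - 1) * d%:R * block_coherence D) ^+ 2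
          * d%:R * k%:R * sigma ^+ 2 * ln (M * d)%:R]) /\
    ((1 - (4 / 5) * d%:R * ((2 * alpha * d%:R * ln (M * d)%:R) `^ (d%:R / 2 - 1))
          / ((M * d)%:R `^ (alpha * d%:R - 1)))%:E < P A)%E.

Proof.
move=> d0 LN unitD _ Sk x0 sigma0 indep law alphage sep.
set nu := sub_coherence D in sep *; set mu := block_coherence D in sep *.
set N : R := (M * d)%:R.
have [i0 _] := bsupp0P x0.
have M0 : (0 < M)%N by exact: leq_ltn_trans (ltn_ord i0).
(* Needed for [ln N > 0]. Otherwise [L = 0], and a column without entries cannot have norm 1. *)
have N1 : (1 < M * d)%N.
  rewrite ltnNge; apply/negP => N1.
  have L0 : L = 0%N by apply/eqP; rewrite -leqn0 -ltnS (leq_trans LN).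
  have c : 'I_(M * d) by apply: (@Ordinal _ 0); rewrite muln_gt0 M0.
  have := unitD c; rewrite /vnorm big1 ?sqrtr0 => [/esym/eqP|r _]; first by rewrite oner_eq0.
  by have := ltn_ord r; rewrite {2}L0.
have lnN : 0 < ln N by rewrite ln_gt0// ltr1n.
have dR : 0 < d%:R :> R by rewrite ltr0n.
have MR : 0 < M%:R :> R by rewrite ltr0n.
have NR : 0 < N by rewrite ltr0n (ltn_trans _ N1).
pose t := 2 * alpha * d%:R * ln N.
(* This is the lower bound on [alpha], rewritten. *)
have t1 : 1 <= t.
  move: alphage; rewrite ler_pdivrMr ?mulr_gt0// => h; apply: le_trans h _.
  by rewrite /t le_eqVlt; apply/orP; left; apply/eqP; ring.
have t0 : 0 < t by exact: lt_le_trans t1.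
pose lam := 1 + (d%:R - 1) * nu.
have lam0 : 0 < lam.
  rewrite ltr_pwDl// mulr_ge0 ?sub_coherence_ge0// subr_ge0 ler1n//.
pose tau := sigma * Num.sqrt (t * lam).
have tau0 : 0 < tau by rewrite mulr_gt0// sqrtr_gt0 mulr_gt0.
have tau2 : tau ^+ 2 = sigma ^+ 2 * (t * lam).
  by rewrite exprMn sqr_sqrtr// mulr_ge0 ?ltW.
have sep' : 2 * tau <= (1 - (d%:R - 1) * nu - (2 * k%:R - 1) * d%:R * mu) * xmin x.
  move: sep; rewrite -mulrBl => h; apply: le_trans h.
  rewrite /tau mulrA le_eqVlt; apply/orP; left; apply/eqP; congr (_ * Num.sqrt _).
  by rewrite /t /lam; ring.
pose noise u : 'cV[R]_L := \col_(r < L) w r u.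
pose F i := [set u | (tau ^+ 2 <= vnorm ((Dblk D i)^T *m noise u) ^+ 2)%R].
have mF i : measurable (F i).
  rewrite -[X in measurable X]setTI.
  have := block_noise_measurable D w i measurableT (measurable_itv `[tau ^+ 2, +oo[).
  congr (measurable (_ `&` _)); apply/seteqP; split => u; by rewrite /= in_itv/= andbT.
have mU : measurable [set u | exists i, F i u].
  have -> : [set u | exists i, F i u] = \bigcup_i F i.
    by apply/seteqP; split => u [i]; [exists i|exists i].
  by apply: fin_bigcup_measurable => //; exact: finite_finset.
(* A pure noise event, measurable and independent of how ties are broken, on which every run
   succeeds. *)
exists (~` [set u | exists i, F i u]); split; first exact: measurableC.
split.
  move=> u /= notF idx xs run.
  have noiselt i : vnorm ((Dblk D i)^T *m noise u) < tau.
    rewrite ltNge; apply/negP => h; apply: notF; exists i.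
    by rewrite /F /= ler_sqr// nnegrE ?vnorm_ge0 ?(ltW tau0).
  have [Ssel err] := bomp_guarantee d0 unitD Sk x0 noiselt tau0 sep' run.
  split=> //; apply: le_trans err _; rewrite tau2 /t /lam -/nu -/mu.
  by rewrite le_eqVlt; apply/orP; left; apply/eqP; ring.
have iidu := iid_normal_standardize sigma0 indep law.
pose B := 4 / 5 * d%:R ^+ 2 * t `^ (d%:R / 2 - 1) * expR (- t / 2).
have PF i : (P (F i) < B%:E)%E.
  have [n nd tail] := block_noise_tail unitD i sigma0 lam0 t0 iidu.
  rewrite /F tau2; apply: le_lt_trans tail _.
  by rewrite lte_fin chi2_bound_lt.
have PU : (P [set u | exists i, F i u] < (M%:R * B)%:E)%E.
  apply: le_lt_trans (measure_union_le P mF) _.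
  have -> : (M%:R * B)%:E = (\sum_(i < M) B%:E)%E.
    by rewrite sumEFin sumr_const card_ord mulr_natl.
  have PFfin i : P (F i) \is a fin_num by exact: fin_num_measure.
  under eq_bigr do rewrite -(fineK (PFfin _)).
  (* Summing keeps the inequality strict because there is at least one block, [i0]. *)
  rewrite !sumEFin lte_fin; apply: ltr_sum => [|i _]; last by rewrite -lte_fin fineK.
  by apply/hasP; exists i0; rewrite ?mem_index_enum.
rewrite probability_setC//.
(* Here [exp(-t / 2) = N^(- alpha d)] and [M d^2 = d N]. *)
have -> : 4 / 5 * d%:R * t `^ (d%:R / 2 - 1) / N `^ (alpha * d%:R - 1) = M%:R * B.
  have -> : N `^ (alpha * d%:R - 1) = expR (t / 2) / N.
    rewrite /powR (gt_eqF NR) mulrBl mul1r expRB lnK ?posrE//.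
    by congr (expR _ / _); rewrite /t; field.
  rewrite /B mulNr expRN /N natrM; field.
  by rewrite !gt_eqF// expR_gt0.
have PUfin : P [set u | exists i, F i u] \is a fin_num by exact: fin_num_measure.
move: PU; rewrite -(fineK PUfin) lte_fin -EFinB lte_fin => h.
by rewrite ltrD2l ltrN2.
Qed.
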